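(* Let $G$ be a finitely generated discrete group and let $\mathscr{T}(G)$ be one of $\mathscr{S}^\infty(G)$, $\mathscr{S}^\omega(G)$, or $\mathscr{O}(G)$. Suppose that $\mathscr{T}\tilde{C}_\bullet(G)$ is contractible, that is, there are bounded linear maps $h_n\colon\mathscr{T}\tilde{C}_n(G)\to\mathscr{T}\tilde{C}_{n+1}(G)$ with $\delta h+h\delta=\mathrm{id}$. Then the group cohomology $H^n(G)$ with coefficients in the trivial representation $\mathbb{R}$ is finite-dimensional for all $n\in\mathbb{N}$.
   Context: All vector spaces are real. A bornology on a vector space $V$ is a collection of subsets, called bounded, such that subsets of bounded sets, finite sets, sums $S_1+S_2$ of bounded sets, and $\bigcup_{|t|\le\lambda}tS$ for $S$ bounded and $\lambda\in\mathbb{R}$ are bounded. A linear map is bounded if it maps bounded sets to bounded sets. $G$ carries the word length function $\ell$ for a finite generating set and the left invariant word metric $d(g,h)=\ell(g^{-1}h)$. Put $X=G$ in the following definitions. Function spaces. For $k\in\mathbb{N}$ let $\|\phi\|^k=\sum_{x}|\phi(x)|(\ell(x)+1)^k$ and for $\alpha>1$ let $|||\phi|||_\alpha=\sum_x|\phi(x)|\alpha^{\ell(x)}$ for $\phi\colon X\to\mathbb{R}$. Let $\mathscr{S}^\infty(X)$ be the space of $\phi$ with $\|\phi\|^k<\infty$ for all $k\in\mathbb{N}$; a subset is bounded if it is bounded for each norm $\|\cdot\|^k$. Let $\mathscr{O}(X)$ be the space of $\phi$ with $|||\phi|||_\alpha<\infty$ for all $\alpha>1$; a subset is bounded if it is bounded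 for every $|||\cdot|||_\alpha$. Let $\mathscr{S}^\omega(X)$ be the space of $\phi$ with $|||\phi|||_\alpha<\infty$ for some $\alpha>1$; a subset is bounded if it is bounded for some $|||\cdot|||_\alpha$ with $\alpha>1$. Tempered chain complexes. For $R\in\mathbb{N}$ let $\mathscr{T}C_n(X)_R$ be the space of functions $\phi\colon X^{n+1}\to\mathbb{R}$ such that $\phi(x_0,\dots,x_n)=0$ whenever $d(x_i,x_j)>R$ for some $i,j$ or $x_j=x_{j+1}$ for some $j$, and such that the function $x\mapsto\sum_{x_1,\dots,x_n}|\phi(x,x_1,\dots,x_n)|$ belongs to $\mathscr{T}(X)$. A subset is bounded if the associated set of functions in $\mathscr{T}(X)$ is bounded. Let $\mathscr{T}C_n(X)=\bigcup_R\mathscr{T}C_n(X)_R$, where a subset is bounded if it is contained and bounded in some $\mathscr{T}C_n(X)_R$. The boundary map $\delta\colon\mathscr{T}C_n(X)\to\mathscr{T}C_{n-1}(X)$ is the bounded extension of $\delta(x_0,\dots,x_n)=\sum_{j=0}^n(-1)^j(x_0,\dots,\widehat{x_j},\dots,x_n)$, where a tuple denotes its characteristic function and tuples with two equal consecutive entries are regarded as $0$. The augmentation is $\alpha\colon\mathscr{T}C_0(X)=\mathscr{T}(X)\to\mathbb{R}$, $\alpha(\phi)=\sum_x\phi(x)$. The reduced complex $\mathscr{T}\tilde{C}_\bullet(X)$ has $\mathscr{T}\tilde{C}_0(X)=\ker\alpha$ and $\mathscr{T}\tilde{C}_n(X)=\mathscr{T}C_n(X)$ for $n\ge1$, with boundary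 map $\delta$. *)

(* Defs.v *)
From HB Require Import structures.
From mathcomp Require Import all_boot all_order all_algebra.
From mathcomp Require Import mathcomp_extra boolp classical_sets functions.
From mathcomp Require Import cardinality fsbigop reals ereal esum.

Set Implicit Arguments.
Unset Strict Implicit.
Unset Printing Implicit Defensive.
Import Order.TTheory GRing.Theory Num.Theory.
Local Open Scope classical_set_scope.
Local Open Scope ring_scope.

(* MathComp with MathComp-Analysis; [groupType] is the structure of possibly  *)
(* infinite groups.                                                           *)

Section WordMetric.
Variables (G : groupType) (S : seq G).

Definition word_of_length (n : nat) (g : G) : Prop :=
  exists w : seq G, [/\ size w = n,
    {subset w <= S ++ [seq (s^-1)%g | s <- S]} & (\prod_(s <- w) s)%g = g].

Definition generates : Prop := forall g : G, exists n, word_of_length n g.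

(* The default value 0 is only used when S does not generate G. *)
Definition word_length (g : G) : nat :=
  if pselect (exists n, `[< word_of_length n g >]) is left ex
  then ex_minn ex else 0%N.

Definition word_dist (g h : G) : nat := word_length (g^-1 * h)%g.

End WordMetric.

Section Bornology.
Variables (R : realType) (V W : lmodType R).

Definition linear_on (C : set V) (f : V -> W) : Prop :=
  forall (a : R) (u v : V), C u -> C v -> f (a *: u + v) = a *: f u + f v.

(* A linear map from the subspace C to the subspace D is represented by a     *)
(* function on the ambient space, whose values outside C are irrelevant;      *)
(* bC and bD are the families of bounded subsets.                             *)
Definition bounded_linear_map (C : set V) (bC : set (set V))
    (D : set W) (bD : set (set W)) (f : V -> W) : Prop :=
  [/\ forall u, C u -> D (f u),
      linear_on C f &
      forall A, A `<=` C -> bC A -> bD (f @` A)].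

(* For subspaces B included in Z: the classes of finitely many elements of Z  *)
(* span Z / B.                                                                *)
Definition finite_dim_quotient (Z B : set V) : Prop :=
  exists (m : nat) (e : 'I_m -> V), (forall i, Z (e i)) /\
    forall z, Z z -> exists c : 'I_m -> R, B (z - \sum_(i < m) c i *: e i).

End Bornology.

Section FunctionSpaces.
Variables (R : realType) (G : groupType) (S : seq G).
Implicit Types (phi : G -> R) (A : set (G -> R)).

Definition poly_norm (k : nat) phi : \bar R :=
  \esum_(x in [set: G]) (`|phi x| * (word_length S x).+1%:R ^+ k)%:E.

Definition exp_norm (a : R) phi : \bar R :=
  \esum_(x in [set: G]) (`|phi x| * a ^+ word_length S x)%:E.

Definition norm_bounded (N : (G -> R) -> \bar R) A : Prop :=
  exists M : R, forall phi, A phi -> (N phi <= M%:E)%E.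

End FunctionSpaces.

Inductive decay := Sinfty | Somega | Ospace.

Section TemperedComplex.
Variables (R : realType) (G : groupType) (S : seq G) (T : decay).

Definition tempered (phi : G -> R) : Prop :=
  match T with
  | Sinfty => forall k : nat, (poly_norm S k phi < +oo)%E
  | Somega => exists2 a : R, 1 < a & (exp_norm S a phi < +oo)%E
  | Ospace => forall a : R, 1 < a -> (exp_norm S a phi < +oo)%E
  end.

Definition tempered_bounded (A : set (G -> R)) : Prop :=
  match T with
  | Sinfty => forall k : nat, norm_bounded (poly_norm S k) A
  | Somega => exists2 a : R, 1 < a & norm_bounded (exp_norm S a) A
  | Ospace => forall a : R, 1 < a -> norm_bounded (exp_norm S a) A
  end.

(* Functions on X^(n+1); R^o is R seen as a vector space over itself. *)
Definition cfun (n : nat) := {ffun 'I_n.+1 -> G} -> R^o.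

Definition degenerate (n : nat) (x : {ffun 'I_n.+1 -> G}) : Prop :=
  exists i j : 'I_n.+1, j = i.+1 :> nat /\ x i = x j.

(* x |-> \sum_(x_1, ..., x_n) |phi(x, x_1, ..., x_n)|. This is a finitely     *)
(* supported sum for the phi of finite propagation, to which it is applied.   *)
Definition row_norm (n : nat) (phi : cfun n) : G -> R := fun x =>
  \sum_(t \in [set t : {ffun 'I_n.+1 -> G} | t ord0 = x]) `|phi t|.

Definition chain_r (r n : nat) : set (cfun n) := [set phi : cfun n |
  [/\ forall x : {ffun 'I_n.+1 -> G},
        (exists i j : 'I_n.+1, (r < word_dist S (x i) (x j))%N) -> phi x = 0,
      forall x, degenerate x -> phi x = 0 &
      tempered (row_norm phi)]].

Definition chain (n : nat) : set (cfun n) :=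
  [set phi : cfun n | exists r : nat, chain_r r phi].

Definition chain_bounded (n : nat) : set (set (cfun n)) := [set A |
  exists r : nat, A `<=` @chain_r r n /\
    tempered_bounded (@row_norm n @` A)].

Definition face (n : nat) (j : 'I_n.+2) (x : {ffun 'I_n.+2 -> G}) :
    {ffun 'I_n.+1 -> G} := [ffun i => x (lift j i)].

(* The value at y of \sum_j (-1)^j (x_0, ..., ^x_j, ..., x_n+1). *)
Definition bd_tuple (n : nat) (x : {ffun 'I_n.+2 -> G}) : cfun n := fun y =>
  if `[< degenerate y >] then 0
  else \sum_(j < n.+2) (-1) ^+ j * (face j x == y)%:R.

(* The bounded extension of bd_tuple, phi |-> \sum_x phi(x) bd_tuple(x): for  *)
(* phi of finite propagation and y fixed, only finitely many x contribute,    *)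
(* because they have a face equal to y and y has at least one vertex.         *)
Definition boundary (n : nat) (phi : cfun n.+1) : cfun n := fun y =>
  \sum_(x \in [set: {ffun 'I_n.+2 -> G}]) phi x * bd_tuple x y.

Lemma boundary_tuple (n : nat) (x : {ffun 'I_n.+2 -> G}) :
  boundary (fun z => (z == x)%:R) = bd_tuple x.
Proof.
apply/funext => y; rewrite /boundary -(fsbig_widen [set x]) //=.
  by rewrite fsbig_set1 eqxx mul1r.
by move=> z [_ /eqP/negPf zx] /=; rewrite zx mul0r.
Qed.

(* The sum of an absolutely summable real family. *)
Definition rsum (I : choiceType) (f : I -> R) : R :=
  fine (\esum_(i in [set: I]) (Num.max (f i) 0)%:E)
  - fine (\esum_(i in [set: I]) (Num.max (- f i) 0)%:E).

Definition augmentation (phi : cfun 0) : R := rsum phi.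

Definition reduced_chain (n : nat) : set (cfun n) :=
  match n return set (cfun n) with
  | 0 => [set phi : cfun 0 | chain phi /\ augmentation phi = 0]
  | m.+1 => @chain m.+1
  end.

Definition contractible_reduced_complex : Prop :=
  exists h : forall n, cfun n -> cfun n.+1,
    [/\ forall n, bounded_linear_map (@reduced_chain n) (@chain_bounded n)
          (@reduced_chain n.+1) (@chain_bounded n.+1) (h n),
        forall phi, reduced_chain phi -> boundary (h 0%N phi) = phi &
        forall n (phi : cfun n.+1), reduced_chain phi ->
          boundary (h n.+1 phi) + h n (boundary phi) = phi].

End TemperedComplex.

(* Cohomology of G with trivial coefficients R, computed from the G-invariant *)
(* homogeneous cochains of the standard resolution: n-cochains are the        *)
(* functions on G^(n+1) invariant under diagonal left translation.            *)
Section GroupCohomology.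
Variables (R : realType) (G : groupType).

Definition translate (n : nat) (g : G) (x : {ffun 'I_n.+1 -> G}) :
    {ffun 'I_n.+1 -> G} := [ffun i => (g * x i)%g].

Definition cochain (n : nat) : set (cfun R G n) :=
  [set f | forall g x, f (translate g x) = f x].

Definition coboundary (n : nat) (f : cfun R G n) : cfun R G n.+1 := fun x =>
  \sum_(j < n.+2) (-1) ^+ j * f (face j x).

Definition cocycles (n : nat) : set (cfun R G n) :=
  [set f | cochain f /\ coboundary f = 0].

Definition coboundaries (n : nat) : set (cfun R G n) :=
  match n return set (cfun R G n) with
  | 0 => [set 0]
  | m.+1 => @coboundary m @` @cochain m
  end.

Definition finite_dim_group_cohomology (n : nat) : Prop :=
  finite_dim_quotient (@cocycles n) (@coboundaries n).

End GroupCohomology.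

(* Main.v *)
Require Import Defs.
From mathcomp Require Import all_boot all_order all_algebra.
From mathcomp Require Import boolp classical_sets functions.
From mathcomp Require Import cardinality fsbigop reals ereal esum.
From mathcomp Require Import zify ring lra.

(** The idea is to compare the standard resolution, whose n-chains are spanned by
    all (n+1)-tuples of group elements, with the tempered complex, and to exploit
    that a bounded contraction h controls propagation uniformly.

    Since the modules of the standard resolution are free and the tempered complex
    is exact, there is an equivariant chain map F from the former to the latter
    which is the identity on vertices: [chain_map] is defined recursively by
    F(x) = x_0 h(F(d(x_0^-1 x))). A similar recursion gives an equivariant
    homotopy H, [chain_homotopy], between F and the map [tuple_chain] which takes
    a nondegenerate tuple to its characteristic function. The decisive point is
    that the values of F in degree n have propagation at most some r that does not
    depend on the tuple ([chain_map_spec]), whereas the tuples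
    themselves have arbitrary diameter. It rests on [uniform_propagation]: for each
    r there is r' such that h maps all chains of propagation r to chains of
    propagation r'. For characteristic functions of tuples this holds because
    suitable multiples of them form a bounded set, and the image of a bounded set
    has bounded propagation. For general chains one approximates by finitely
    supported ones; the truncation errors, multiplied by the truncation radius,
    form a bounded set, for each of the three decay conditions.

    An invariant cochain takes finitely many values on tuples of bounded diameter,
    so it can be summed against tempered chains, and for normalised cochains the
    coboundary is adjoint to the boundary map ([pair_boundary]). Let c be a
    normalised n-cocycle that vanishes on all tuples of diameter at most r. Then
    <c, F(x)> = 0, and the homotopy formula shows that c is the coboundary of
    x |-> <c, H(x)> ([normalised_cocycle_small_coboundary]). A cocycle that is not
    normalised is first corrected by a coboundary which also vanishes on the tuples
    of diameter at most r ([normalise]). Hence the class of an n-cocycle is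
    determined by its restriction to the tuples of diameter at most r, and by
    invariance this amounts to finitely many real numbers. *)

Set Implicit Arguments.
Unset Strict Implicit.
Unset Printing Implicit Defensive.
Import Order.TTheory GRing.Theory Num.Theory.
Local Open Scope classical_set_scope.
Local Open Scope ring_scope.

(** * Absolutely summable real families *)

Section Summation.
Variable R : realType.

Definition abs_summable (I : choiceType) (f : I -> R) : Prop :=
  (\esum_(i in [set: I]) (`|f i|)%:E < +oo)%E.

Section OneFamily.
Variable I : choiceType.
Implicit Types f g p q : I -> R.

Lemma esum_ge0R f : (forall i, 0 <= f i) ->
  (0 <= \esum_(i in [set: I]) (f i)%:E)%E.
Proof. by move=> f0; apply: esum_ge0 => i _; rewrite lee_fin. Qed.

Lemma abs_summable_le f g : (forall i, `|f i| <= `|g i|) ->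
  abs_summable g -> abs_summable f.
Proof.
by move=> fg; apply: le_lt_trans; apply: le_esum => i _; rewrite lee_fin.
Qed.

Lemma abs_summable_nneg p : (forall i, 0 <= p i) -> abs_summable p ->
  (\esum_(i in [set: I]) (p i)%:E)%E \is a fin_num.
Proof.
move=> p0 sp; rewrite ge0_fin_numE ?esum_ge0R//.
rewrite (_ : (fun i => _) = (fun i => (`|p i|)%:E))//.
by apply/funext => i; rewrite ger0_norm.
Qed.

Lemma abs_summableD f g : abs_summable f -> abs_summable g ->
  abs_summable (fun i => f i + g i).
Proof.
move=> sf sg; apply: le_lt_trans (lte_add_pinfty sf sg).
rewrite -esumD => [|i _|i _]; rewrite ?lee_fin//.
by apply: le_esum => i _; rewrite -EFinD lee_fin ler_normD.
Qed.

(** The freedom in the choice of p and q makes [rsum] additive: the positive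
    part of a sum is not the sum of the positive parts. *)
Lemma rsumE f p q : (forall i, 0 <= p i) -> (forall i, 0 <= q i) ->
  abs_summable p -> abs_summable q -> (forall i, f i = p i - q i) ->
  rsum f = fine (\esum_(i in [set: I]) (p i)%:E)
           - fine (\esum_(i in [set: I]) (q i)%:E).
Proof.
move=> p0 q0 sp sq fE.
have m0 (x : R) : 0 <= Num.max x 0 by rewrite le_max lexx orbT.
have fp : (\esum_(i in [set: I]) (Num.max (f i) 0)%:E)%E \is a fin_num.
  apply: abs_summable_nneg => //; apply: abs_summable_le sp => i.
  rewrite !ger0_norm// fE ge_max p0 andbT; have := q0 i; lra.
have fq : (\esum_(i in [set: I]) (Num.max (- f i) 0)%:E)%E \is a fin_num.
  apply: abs_summable_nneg => //; apply: abs_summable_le sq => i.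
  rewrite !ger0_norm// fE ge_max q0 andbT; have := p0 i; lra.
have pn := abs_summable_nneg p0 sp; have qn := abs_summable_nneg q0 sq.
apply/eqP; rewrite /rsum subr_eq addrAC eq_sym subr_eq eq_sym.
rewrite -!fineD//; apply/eqP; congr fine.
rewrite -!esumD// => [|i _|i _|i _|i _]; rewrite ?lee_fin//.
apply: eq_esum => i _; rewrite -!EFinD; congr EFin; rewrite fE.
by rewrite !maxEle; case: ifP; case: ifP; move: (p0 i) (q0 i); lra.
Qed.

Lemma rsumD f g : abs_summable f -> abs_summable g ->
  rsum (fun i => f i + g i) = rsum f + rsum g.
Proof.
move=> sf sg.
have m0 (x : R) : 0 <= Num.max x 0 by rewrite le_max lexx orbT.
have mp (x : R) : x = Num.max x 0 - Num.max (- x) 0.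
  by rewrite !maxEle; case: ifP; case: ifP; lra.
have mle (x : R) : `|Num.max x 0| <= `|x|.
  by rewrite ger0_norm// ge_max ler_norm normr_ge0.
have mleN (x : R) : `|Num.max (- x) 0| <= `|x| by rewrite -(normrN x).
have sM (k : I -> R) : abs_summable k ->
    abs_summable (fun i => Num.max (k i) 0) /\
    abs_summable (fun i => Num.max (- k i) 0).
  by move=> sk; split; apply: abs_summable_le sk.
have [[fp fn] [gp gn]] := (sM _ sf, sM _ sg).
rewrite (@rsumE _ (fun i => Num.max (f i) 0 + Num.max (g i) 0)
  (fun i => Num.max (- f i) 0 + Num.max (- g i) 0)).
- rewrite /rsum.
  under eq_esum do rewrite EFinD.
  rewrite esumD// => [|i _|i _]; rewrite ?lee_fin//.
  under [X in _ - fine X = _]eq_esum do rewrite EFinD.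
  rewrite esumD// => [|i _|i _]; rewrite ?lee_fin//.
  rewrite !fineD; try by apply: abs_summable_nneg.
  lra.
- by move=> i; rewrite addr_ge0.
- by move=> i; rewrite addr_ge0.
- exact: abs_summableD.
- exact: abs_summableD.
- by move=> i; move: (mp (f i)) (mp (g i)); lra.
Qed.

Lemma rsumN f : rsum (fun i => - f i) = - rsum f.
Proof.
rewrite /rsum opprB; congr (_ - fine _).
by apply: eq_esum => i _; rewrite opprK.
Qed.

Lemma rsum0 : rsum (fun _ : I => 0 : R) = 0.
Proof. by rewrite /rsum oppr0 subrr. Qed.

Lemma esum_single f i : (forall j, 0 <= f j) -> (forall j, j <> i -> f j = 0) ->
  (\esum_(j in [set: I]) (f j)%:E = (f i)%:E)%E.
Proof.
move=> f0 fi; rewrite -[RHS](@esum_set1 _ _ i (EFin \o f)) ?lee_fin// [RHS]esum_mkcond.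
apply: eq_esum => j _; case: ifPn => // /negP; rewrite inE => ji.
by rewrite fi// => ij; apply: ji; rewrite inE.
Qed.

Lemma abs_summable_single f i : (forall j, j <> i -> f j = 0) ->
  abs_summable f.
Proof.
move=> fi; rewrite /abs_summable (@esum_single (fun j => `|f j|) i) ?ltry// => j ji.
by rewrite fi// normr0.
Qed.

Lemma rsum_single f i : (forall j, j <> i -> f j = 0) -> rsum f = f i.
Proof.
move=> fi.
have m0 (x : R) : 0 <= Num.max x 0 by rewrite le_max lexx orbT.
rewrite /rsum (@esum_single (fun j => Num.max (f j) 0) i)//; last first.
  by move=> j ji; rewrite fi// maxxx.
rewrite (@esum_single (fun j => Num.max (- f j) 0) i)//; last first.
  by move=> j ji; rewrite fi// oppr0 maxxx.
by rewrite /= !maxEle; case: ifP; case: ifP; lra.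
Qed.

End OneFamily.

Lemma rsum_reindex (I J : choiceType) (e : I -> J) (f : J -> R) :
  bijective e -> rsum (f \o e) = rsum f.
Proof.
rewrite -setTT_bijective => eb.
by congr (fine _ - fine _); rewrite (reindex_esum _ _ _ _ eb).
Qed.

Lemma abs_summable_sum (I : choiceType) (k : nat) (f : 'I_k -> I -> R) :
  (forall j, abs_summable (f j)) ->
  abs_summable (fun i => \sum_(j < k) f j i) /\
  rsum (fun i => \sum_(j < k) f j i) = \sum_(j < k) rsum (f j).
Proof.
elim: k f => [|k IH] f sf.
  under eq_fun do rewrite big_ord0; rewrite big_ord0 rsum0; split=> //.
  rewrite /abs_summable esum1 ?ltry// => i _; by rewrite normr0.
have [s1 r1] := IH (fun j => f (widen_ord (leqnSn k) j)) (fun j => sf _).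
under eq_fun do rewrite big_ord_recr /=.
by rewrite big_ord_recr /= -r1 -rsumD//; split => //; apply: abs_summableD.
Qed.

Lemma esum_fibres (I J : choiceType) (p : I -> J) (g : I -> R) :
  (forall i, 0 <= g i) ->
  (\esum_(j in [set: J]) \esum_(i in p @^-1` [set j]) (g i)%:E =
   \esum_(i in [set: I]) (g i)%:E)%E.
Proof.
move=> g0; rewrite esum_esum; last by move=> j i _ _; rewrite lee_fin.
rewrite (@reindex_esum _ _ _ [set: I] _ (fun i => (p i, i)))//.
by split=> [i _ //|i j _ _ [] //|[j i] [_ /= <-]]; exists i.
Qed.

(** The inner sums are finite sums, hence the auxiliary sets A j: they contain
    the part of the fibre over j where f does not vanish. The positive and the
    negative part of f are summed along the fibres separately. *)
Lemma rsum_fibres (I J : choiceType) (p : I -> J) (f : I -> R) (A : J -> set I) :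
  (forall j, finite_set (A j)) -> (forall i, f i <> 0 -> A (p i) i) ->
  abs_summable f ->
  abs_summable (fun j => \sum_(i \in A j) f i * (p i == j)%:R) /\
  rsum (fun j => \sum_(i \in A j) f i * (p i == j)%:R) = rsum f.
Proof.
move=> finA fA sf.
(* for nonnegative families, [esum_fibres] applies after restriction to A j *)
have main (g : I -> R) : (forall i, 0 <= g i) -> (forall i, f i = 0 -> g i = 0) ->
    (\esum_(j in [set: J]) (\sum_(i \in A j) g i * (p i == j)%:R)%:E =
     \esum_(i in [set: I]) (g i)%:E)%E.
  move=> g0 gf.
  rewrite -(esum_fibres p)//.
  apply: eq_esum => j _.
  rewrite fsbig_finite//= -sumEFin -fsbig_finite// -esum_fset//; last first.
    by move=> i _; rewrite lee_fin mulr_ge0// ler0n.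
  rewrite esum_mkcond [RHS]esum_mkcond; apply: eq_esum => i _.
  case: (asboolP (p i = j)) => [pj|/eqP/negPf pj].
    rewrite [in RHS]mem_set// pj eqxx mulr1; case: ifPn => // /negP.
    rewrite inE => nA; apply/esym; congr EFin; apply: gf.
    by apply: contrapT => /fA; rewrite pj.
  rewrite [RHS]ifN; last by apply/negP; rewrite inE /= => /eqP; rewrite pj.
  by rewrite pj mulr0 if_same.
set P := fun i => Num.max (f i) 0; set Q := fun i => Num.max (- f i) 0.
have P0 i : 0 <= P i by rewrite le_max lexx orbT.
have Q0 i : 0 <= Q i by rewrite le_max lexx orbT.
have PP i : f i = 0 -> P i = 0 by rewrite /P => ->; rewrite maxxx.
have QP i : f i = 0 -> Q i = 0 by rewrite /Q => ->; rewrite oppr0 maxxx.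
have PQ i : f i = P i - Q i.
  by rewrite /P /Q !maxEle; case: ifP; case: ifP; lra.
have sP : abs_summable P.
  by apply: abs_summable_le sf => i; rewrite ger0_norm// ge_max ler_norm normr_ge0.
have sQ : abs_summable Q.
  by apply: abs_summable_le sf => i; rewrite ger0_norm// -normrN ge_max ler_norm normr_ge0.
pose push (g : I -> R) j := \sum_(i \in A j) g i * (p i == j)%:R.
have push0 g : (forall i, 0 <= g i) -> forall j, 0 <= push g j.
  by move=> g0 j; apply: fsumr_ge0 => i _; rewrite mulr_ge0// ler0n.
have spush g : (forall i, 0 <= g i) -> (forall i, f i = 0 -> g i = 0) ->
    abs_summable g -> abs_summable (push g).
  move=> g0 gf sg; rewrite /abs_summable.
  under eq_esum do rewrite ger0_norm ?push0//.
  rewrite main//; move: sg; rewrite /abs_summable.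
  by under eq_esum do rewrite ger0_norm//.
have pushE j : push f j = push P j - push Q j.
  rewrite /push !fsbig_finite//= -sumrB; apply: eq_bigr => i _.
  by rewrite -mulrBl -PQ.
split.
  have sPQ : abs_summable (fun j => push P j + push Q j).
    by apply: abs_summableD; apply: spush.
  apply: abs_summable_le sPQ => j.
  rewrite [X in `|X| <= _]pushE [leRHS]ger0_norm ?addr_ge0 ?push0//.
  rewrite (le_trans (ler_normB _ _))// !ger0_norm ?push0//.
rewrite (rsumE P0 Q0 sP sQ PQ) -(main P)// -(main Q)//.
by apply: rsumE => //; [exact: push0|exact: push0|exact: spush|exact: spush].
Qed.

End Summation.

(** * Word length and tuples *)

Section WordLength.
Variables (G : groupType) (S : seq G).
Hypothesis gS : generates S.

Notation ell := (word_length S).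

Lemma word_lengthP g : word_of_length S (ell g) g.
Proof.
rewrite /word_length; case: pselect => [ex|[]].
  by case: ex_minnP => n /asboolP.
by have [n wn] := gS g; exists n; apply/asboolP.
Qed.

Lemma word_length_le n g : word_of_length S n g -> (ell g <= n)%N.
Proof.
move=> wn; rewrite /word_length; case: pselect => // ex.
by case: ex_minnP => k _ /(_ n); apply; apply/asboolP.
Qed.

Lemma word_length1 : ell 1%g = 0%N.
Proof.
by apply/eqP; rewrite -leqn0; apply: word_length_le; exists [::]; rewrite big_nil.
Qed.

Lemma word_lengthM g h : (ell (g * h)%g <= ell g + ell h)%N.
Proof.
have [v [vn vS vE]] := word_lengthP g; have [w [wn wS wE]] := word_lengthP h.
apply: word_length_le; exists (v ++ w); split.
- by rewrite size_cat vn wn.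
- by move=> x; rewrite mem_cat => /orP[/vS|/wS].
- by rewrite big_cat/= vE wE.
Qed.

Lemma word_dist_mul g x y : word_dist S (g * x)%g (g * y)%g = word_dist S x y.
Proof. by rewrite /word_dist invgM -mulgA mulKg. Qed.

Lemma finite_sphere n : finite_set [set g : G | word_of_length S n g].
Proof.
elim: n => [|n IH].
  apply: sub_finite_set (finite_set1 (1%g : G)) => g [w [w0 _ <-]].
  by rewrite (size0nil w0) big_nil.
set A := S ++ [seq (s^-1)%g | s <- S].
apply: (@sub_finite_set _ _
  ((fun p => (p.1 * p.2)%g) @` ([set` A] `*` [set g : G | word_of_length S n g]))).
  move=> g /= [w [wn wA wE]]; case: w => [//|s w] in wn wA wE *.
  case: wn => wn; rewrite -wE big_cons.
  exists (s, (\prod_(j <- w) j)%g) => //; split.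
    by apply: wA; rewrite mem_head.
  by exists w; split=> // x xw; apply: wA; rewrite inE xw orbT.
exact/finite_image/finite_setX.
Qed.

Lemma finite_ball n : finite_set [set g : G | (ell g <= n)%N].
Proof.
elim: n => [|n IH].
  apply: sub_finite_set (finite_sphere 0) => g /=; rewrite leqn0 => /eqP <-.
  exact: word_lengthP.
apply: (@sub_finite_set _ _
  ([set g : G | (ell g <= n)%N] `|` [set g : G | word_of_length S n.+1 g])).
  move=> g /=; rewrite leq_eqVlt => /orP[/eqP <-|]; last by left.
  by right; exact: word_lengthP.
by rewrite finite_setU; split => //; exact: finite_sphere.
Qed.

End WordLength.

Section Tuples.
Variables (G : groupType) (S : seq G).

(** The simplices of the Rips complex with parameter r. *)
Definition small (r n : nat) (x : {ffun 'I_n -> G}) : Prop :=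
  forall i j, (word_dist S (x i) (x j) <= r)%N.

Lemma finite_ffuns (n : nat) (B : set G) : finite_set B ->
  finite_set [set x : {ffun 'I_n -> G} | forall i, B (x i)].
Proof.
move=> /finite_seqP[s ->].
pose f (k : {ffun 'I_n -> 'I_(size s)}) : {ffun 'I_n -> G} :=
  [ffun i => nth 1%g s (k i)].
apply: (@sub_finite_set _ _ (f @` setT)); last exact/finite_image/finite_finset.
move=> x /= xs.
have lt i : (index (x i) s < size s)%N by rewrite index_mem; exact: xs.
exists [ffun i => Ordinal (lt i)] => //; apply/ffunP => i.
by rewrite !ffunE /= nth_index//; exact: xs.
Qed.

Hypothesis gS : generates S.

(** All vertices of a small tuple lie in the ball of radius r around any one of
    them. *)
Lemma finite_small_at (r n : nat) (i : 'I_n) (B : set G) : finite_set B ->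
  finite_set [set x : {ffun 'I_n -> G} | small r x /\ B (x i)].
Proof.
move=> finB.
set D := [set (p.1 * p.2)%g | p in B `*` [set g : G | (word_length S g <= r)%N]].
apply: (@sub_finite_set _ _ [set x : {ffun 'I_n -> G} | forall j, D (x j)]).
  move=> x [xr Bx] j; exists (x i, ((x i)^-1 * x j)%g) => /=.
    by split=> //=; exact: xr.
  by rewrite mulVKg.
apply: finite_ffuns; apply/finite_image/finite_setX => //; exact: finite_ball.
Qed.

End Tuples.

Section Translations.
Variable G : groupType.

Lemma translate1 n (x : {ffun 'I_n.+1 -> G}) : translate 1%g x = x.
Proof. by apply/ffunP => i; rewrite ffunE mul1g. Qed.

Lemma translateM n (g h : G) (x : {ffun 'I_n.+1 -> G}) :
  translate g (translate h x) = translate (g * h)%g x.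
Proof. by apply/ffunP => i; rewrite !ffunE mulgA. Qed.

Lemma translateK n (g : G) :
  cancel (@translate G n g) (translate g^-1%g).
Proof. by move=> x; rewrite translateM mulVg translate1. Qed.

Lemma translateVK n (g : G) :
  cancel (@translate G n g^-1%g) (translate g).
Proof. by move=> x; rewrite translateM mulgV translate1. Qed.

Lemma translate_bij n (g : G) : bijective (@translate G n g).
Proof. by exists (translate g^-1%g); [exact: translateK|exact: translateVK]. Qed.

Lemma face_translate n (g : G) (j : 'I_n.+2) (x : {ffun 'I_n.+2 -> G}) :
  face j (translate g x) = translate g (face j x).
Proof. by apply/ffunP => i; rewrite !ffunE. Qed.

Lemma degenerate_translate n (g : G) (x : {ffun 'I_n.+1 -> G}) :
  degenerate (translate g x) <-> degenerate x.
Proof.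
split=> -[i [j [ij e]]]; exists i, j; split => //; last by rewrite !ffunE e.
by move: e; rewrite !ffunE => /mulgI.
Qed.

Lemma small_translate (S : seq G) r n (g : G) (x : {ffun 'I_n.+1 -> G}) :
  small S r (translate g x) <-> small S r x.
Proof.
by split=> h i j; have := h i j; rewrite !ffunE word_dist_mul.
Qed.

Lemma small_face (S : seq G) r n (j : 'I_n.+2) (x : {ffun 'I_n.+2 -> G}) :
  small S r x -> small S r (face j x).
Proof. by move=> h i k; rewrite !ffunE. Qed.

Lemma small_le (S : seq G) r r' n (x : {ffun 'I_n -> G}) : (r <= r')%N ->
  small S r x -> small S r' x.
Proof. by move=> rr h i j; exact: leq_trans (h i j) rr. Qed.

End Translations.

(** * Alternating sums over faces *)

Section AlternatingSums.
Variables (R : realType) (G : groupType) (V : lmodType R).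

Definition altsum (n : nat) (f : {ffun 'I_n.+1 -> G} -> V)
    (x : {ffun 'I_n.+2 -> G}) : V :=
  \sum_(j < n.+2) (-1) ^+ j *: f (face j x).

(** The double sum of a simplicial identity cancels: the terms below the
    diagonal are moved onto those above it with the opposite sign. *)
Lemma simplicial_cancel (N : nat) (g : nat -> nat -> V) :
  (forall i j, (j < i)%N -> (i <= N)%N -> g i j = g j i.-1) ->
  \sum_(i < N.+1) \sum_(j < N) (-1) ^+ (i + j) *: g i j = 0.
Proof.
move=> gE.
under eq_bigr => i _ do rewrite (bigID (fun j : 'I_N => (j < i)%N)) /=.
rewrite big_split /= addrC; apply/eqP; rewrite addr_eq0; apply/eqP.
rewrite big_ord_recr /= [X in _ + X]big1 ?addr0; last first.
  by move=> j /negP []; exact: ltn_ord.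
rewrite big_ord_recl /= [X in X + _]big1 ?add0r// -sumrN.
transitivity (\sum_(i < N) \sum_(j < N | (i <= j)%N) (-1) ^+ (i + j) *: g i j).
  by apply: eq_bigr => i _; apply: eq_bigl => j; rewrite -leqNgt.
rewrite (exchange_big_dep predT)//=; apply: eq_bigr => j _.
rewrite -sumrN; apply: eq_big => [i|i ij]; first by rewrite /bump /= add1n ltnS.
have jN := ltn_ord j.
rewrite /bump /= add1n (@gE j.+1 i) ?ltnS// addSn exprS mulN1r scaleNr opprK.
by rewrite addnC.
Qed.

Lemma altsum_nat (n : nat) (f : {ffun 'I_n.+1 -> G} -> V)
    (x : {ffun 'I_n.+2 -> G}) :
  altsum f x = \sum_(0 <= j < n.+2) (-1) ^+ j *: f (face (inord j) x).
Proof. by rewrite big_mkord; apply: eq_bigr => j _; rewrite inord_val. Qed.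

Lemma altsum_altsum (n : nat) (f : {ffun 'I_n.+1 -> G} -> V)
    (x : {ffun 'I_n.+3 -> G}) : altsum (altsum f) x = 0.
Proof.
rewrite -(@simplicial_cancel n.+2 (fun i j => f (face (inord j) (face (inord i) x)))).
  apply: eq_bigr => i _; rewrite scaler_sumr; apply: eq_bigr => j _.
  by rewrite scalerA exprD !inord_val.
move=> i j ji iN; congr f; apply/ffunP => k; rewrite !ffunE; congr (x _).
have kn := ltn_ord k.
apply/val_inj; rewrite /= !inordK /bump ?leq_b1//; lia.
Qed.

Lemma eq_altsum (n : nat) (f g : {ffun 'I_n.+1 -> G} -> V) x :
  (forall y, f y = g y) -> altsum f x = altsum g x.
Proof. by move=> fg; apply: eq_bigr => j _; rewrite fg. Qed.

Lemma altsumB (n : nat) (f g : {ffun 'I_n.+1 -> G} -> V) x :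
  altsum (fun y => f y - g y) x = altsum f x - altsum g x.
Proof. by rewrite -sumrB; apply: eq_bigr => j _; rewrite scalerBr. Qed.

Lemma face_repeat (n : nat) (x : {ffun 'I_n.+2 -> G}) (i j : 'I_n.+2) :
  j = i.+1 :> nat -> x i = x j -> face i x = face j x.
Proof.
move=> ji xij; apply/ffunP => k; rewrite !ffunE.
have [ki|ki] := eqVneq (k : nat) i.
  have -> : lift i k = j by apply/val_inj; rewrite /= /bump ki ji leqnn.
  have -> // : lift j k = i by apply/val_inj; rewrite /= /bump ki ji ltnn.
congr (x _); apply/val_inj; rewrite /= /bump ji; move/eqP: ki; lia.
Qed.

(** The two faces which omit one of two equal consecutive vertices coincide
    and have opposite signs. *)
Lemma altsum_repeat (n : nat) (f : {ffun 'I_n.+1 -> G} -> V)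
    (x : {ffun 'I_n.+2 -> G}) (i j : 'I_n.+2) :
  j = i.+1 :> nat -> x i = x j ->
  altsum f x = \sum_(k < n.+2 | (k != i) && (k != j)) (-1) ^+ k *: f (face k x).
Proof.
move=> ji xij; rewrite /altsum (bigD1 i)//= (bigD1 j)/=; last first.
  by apply/eqP => e; move: ji; rewrite e; lia.
by rewrite addrA (face_repeat ji xij) ji exprS mulN1r scaleNr subrr add0r.
Qed.

End AlternatingSums.

(** * Normalisation of cocycles *)

Section Normalisation.
Variables (R : realType) (G : groupType).

Lemma coboundaryE (n : nat) (f : cfun R G n) x :
  coboundary f x = altsum (V := R^o) f x.
Proof. by []. Qed.

Lemma coboundaryB (n : nat) (f g : cfun R G n) :
  coboundary (f - g) = coboundary f - coboundary g.
Proof. by apply/funext => x; rewrite coboundaryE altsumB. Qed.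

Lemma coboundaryZ (n : nat) (a : R) (f : cfun R G n) :
  coboundary (a *: f) = a *: coboundary f.
Proof.
apply/funext => x; rewrite coboundaryE /altsum.
rewrite [RHS](_ : _ = a * coboundary f x)// mulr_sumr.
by apply: eq_bigr => j _; rewrite mulrCA.
Qed.

Lemma coboundary_coboundary (n : nat) (f : cfun R G n) :
  coboundary (coboundary f) = 0.
Proof. by apply/funext => x; exact: altsum_altsum. Qed.

Lemma cochain_coboundary (n : nat) (f : cfun R G n) :
  cochain f -> cochain (coboundary f).
Proof.
by move=> cf g x; apply: eq_bigr => j _; rewrite face_translate cf.
Qed.

Definition repeats_at (l n : nat) (x : {ffun 'I_n.+1 -> G}) : Prop :=
  exists i j : 'I_n.+1, [/\ i = l :> nat, j = l.+1 :> nat & x i = x j].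

(** The degeneracy operator that repeats the vertex at position k. *)
Definition dup (k n : nat) (x : {ffun 'I_n.+1 -> G}) : {ffun 'I_n.+2 -> G} :=
  [ffun i : 'I_n.+2 => x (inord (unbump k i))].

Lemma repeats_atP (l n : nat) (x : {ffun 'I_n.+1 -> G}) :
  repeats_at l x <-> (l < n)%N /\ x (inord l) = x (inord l.+1).
Proof.
split=> [[i [j [il jl xij]]]|[ln xl]].
  have := ltn_ord j; rewrite jl => ln; split=> //.
  by rewrite -jl -il !inord_val.
by exists (inord l), (inord l.+1); rewrite !inordK//; lia.
Qed.

Lemma repeats_face (l i n : nat) (x : {ffun 'I_n.+2 -> G}) : (i <= n.+1)%N ->
  (i < l)%N -> repeats_at l x -> repeats_at l.-1 (face (inord i) x).
Proof.
move=> iN il /repeats_atP[ln xl]; apply/repeats_atP; split; first by lia.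
rewrite !ffunE; transitivity (x (inord l)); [|rewrite xl]; congr (x _); apply/val_inj;
  rewrite /= !inordK /bump; lia.
Qed.

Lemma repeats_face_above (l i n : nat) (x : {ffun 'I_n.+2 -> G}) : (i <= n.+1)%N ->
  (l.+1 < i)%N -> repeats_at l x -> repeats_at l (face (inord i) x).
Proof.
move=> iN il /repeats_atP[ln xl]; apply/repeats_atP; split; first by lia.
rewrite !ffunE; transitivity (x (inord l)); [|rewrite xl]; congr (x _); apply/val_inj;
  rewrite /= !inordK /bump; lia.
Qed.

Lemma repeats_dup (l k n : nat) (x : {ffun 'I_n.+1 -> G}) :
  (l < k)%N -> repeats_at l x -> repeats_at l (dup k x).
Proof.
move=> lk /repeats_atP[ln xl]; apply/repeats_atP; split; first by lia.
rewrite !ffunE !inordK; try lia.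
have -> : unbump k l = l by rewrite /unbump; lia.
by have -> : unbump k l.+1 = l.+1 by rewrite /unbump; lia.
Qed.

Lemma face_dup_above (k i n : nat) (x : {ffun 'I_n.+2 -> G}) :
  (k.+1 < i <= n.+1)%N ->
  face (inord i.+1) (dup k x) = dup k (face (inord i) x).
Proof.
move=> ki; apply/ffunP => m; rewrite !ffunE; congr (x _); apply/val_inj.
have mn := ltn_ord m.
by rewrite /= !inordK /unbump /= ?inordK /bump; lia.
Qed.

Lemma face_dup_low (k i n : nat) (x : {ffun 'I_n.+2 -> G}) :
  (i < k <= n.+1)%N -> repeats_at k.-1 (face (inord i) (dup k x)).
Proof.
move=> ik; apply/repeats_atP; split; first by lia.
rewrite !ffunE; congr (x _); apply/val_inj.
by rewrite /= !inordK /unbump /= ?inordK /bump; lia.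
Qed.

Lemma face_dup_same (k i n : nat) (x : {ffun 'I_n.+2 -> G}) :
  (k <= n)%N -> x (inord k) = x (inord k.+1) ->
  (k <= i <= k.+2)%N -> face (inord i) (dup k x) = x.
Proof.
move=> kn xk ki; apply/ffunP => m; rewrite !ffunE.
have mn := ltn_ord m.
have [mk|mk] := eqVneq (m : nat) k.+1.
  have [ii|ii] := eqVneq i k.+2.
    rewrite -[RHS]/(x m) -[in RHS](inord_val m) mk -xk; congr (x _); apply/val_inj.
    by rewrite /= !inordK /unbump /= ?inordK /bump; lia.
  rewrite -[in RHS](inord_val m); congr (x _); apply/val_inj.
  by rewrite /= !inordK /unbump /= ?inordK /bump; lia.
rewrite -[in RHS](inord_val m); congr (x _); apply/val_inj.
by rewrite /= !inordK /unbump /= ?inordK /bump; lia.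
Qed.

Lemma degenerateP (n : nat) (x : {ffun 'I_n.+1 -> G}) :
  degenerate x <-> exists l, repeats_at l x.
Proof.
split=> [[i [j [ji xij]]]|[l [i [j [il jl xij]]]]]; first by exists i, i, j.
by exists i, j; split=> //; rewrite jl il.
Qed.

(** The cocycle identity at [dup k x] expresses c x through those terms of the
    coboundary of [fun y => c (dup k y)] at x that do not vanish for trivial
    reasons. *)
Lemma normalise_step (k n : nat) (c : cfun R G n.+1) : (k <= n)%N ->
  coboundary c = 0 ->
  (forall l x, (l < k)%N -> repeats_at l x -> c x = 0) ->
  forall l x, (l <= k)%N -> repeats_at l x ->
    (c - (-1) ^+ k *: coboundary (fun y => c (dup k y) : R^o)) x = 0.
Proof.
move=> kn dc ck l x lk xl.
rewrite [LHS](_ : _ = c x - (-1) ^+ k *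
  altsum (V := R^o) (fun y : {ffun 'I_n.+1 -> G} => c (dup k y)) x)//.
have [ln xle] := (repeats_atP _ _).1 xl.
have low (i : nat) : (i < l)%N -> c (dup k (face (inord i) x)) = 0.
  move=> il; apply: (ck l.-1); first by lia.
  apply: repeats_dup; first by lia.
  by apply: repeats_face => //; lia.
rewrite altsum_nat (@big_cat_nat _ _ _ l)//=; last by lia.
rewrite big_nat big1 ?add0r; last by move=> i il; rewrite low ?scaler0.
rewrite big_ltn; last by lia.
rewrite big_ltn; last by lia.
have -> : face (inord l.+1) x = face (inord l) x.
  by apply/esym/face_repeat => //; rewrite !inordK; lia.
rewrite addrA exprS mulN1r scaleNr subrr add0r.
have [ltlk|kl] := ltnP l k.
  rewrite (ck l)// big_nat big1 ?mulr0 ?subr0// => i il.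
  rewrite (ck l) ?scaler0//; apply: repeats_dup => //.
  by apply: repeats_face_above => //; lia.
have {lk kl} lk : l = k by lia.
subst l.
(* the cocycle identity at the tuple which repeats the vertex k once more *)
have : altsum (V := R^o) c (dup k x) = 0 by rewrite -coboundaryE dc.
rewrite altsum_nat (@big_cat_nat _ _ _ k)//=; last by lia.
rewrite big_nat big1 ?add0r; last first.
  move=> i ik; rewrite (ck k.-1) ?scaler0//; first by lia.
  by apply: face_dup_low; lia.
rewrite big_ltn; last by lia.
rewrite big_ltn; last by lia.
rewrite big_ltn; last by lia.
rewrite !face_dup_same//; try lia.
rewrite big_add1/= !exprS !mulN1r !scaleNr opprK addrA subrr add0r.
rewrite (@eq_big_nat _ _ _ _ _ _
  (fun i => - ((-1) ^+ i *: c (dup k (face (inord i) x))))).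
  rewrite sumrN => /subr0_eq <-.
  by rewrite /GRing.scale /= mulrA -expr2 sqrr_sign mul1r subrr.
by move=> i ik; rewrite exprS mulN1r scaleNr face_dup_above//; lia.
Qed.

Lemma cochain_dup (k n : nat) (c : cfun R G n.+1) :
  cochain c -> cochain (fun y => c (dup k y) : R^o).
Proof.
move=> cc g x; rewrite -[RHS](cc g); congr (c _).
by apply/ffunP => i; rewrite !ffunE.
Qed.

Lemma cochainB (n : nat) (a : R) (f g : cfun R G n) :
  cochain f -> cochain g -> cochain (f - a *: g).
Proof.
move=> cf cg t x.
by rewrite [LHS](_ : _ = f (translate t x) - a * g (translate t x))// cf cg.
Qed.

Lemma small_dup (S : seq G) r k n (x : {ffun 'I_n.+1 -> G}) :
  small S r x -> small S r (dup k x).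
Proof. by move=> xr i j; rewrite !ffunE. Qed.

(** Successive subtraction of the coboundaries of the cochains
    [fun y => c (dup k y)] makes a cocycle vanish on the tuples with a repetition
    at 0, then at 1, and so on; if c vanishes on small tuples, then so do these
    corrections, because faces and repetitions do not increase the diameter. *)
Lemma normalise (S : seq G) r (n : nat) (c : cfun R G n.+1) :
  cocycles c -> (forall x, small S r x -> c x = 0) ->
  exists b : cfun R G n, [/\ cochain b, cocycles (c - coboundary b),
    forall x, small S r x -> (c - coboundary b) x = 0 &
    forall x, degenerate x -> (c - coboundary b) x = 0].
Proof.
move=> [cc dc] csmall.
suff main k : (k <= n.+1)%N -> exists b : cfun R G n, [/\ cochain b,
    cocycles (c - coboundary b),
    forall x, small S r x -> (c - coboundary b) x = 0 &
    forall l x, (l < k)%N -> repeats_at l x -> (c - coboundary b) x = 0].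
  have [b [cb zb sb rb]] := main _ (leqnn n.+1).
  exists b; split=> // x /degenerateP[l xl]; apply: rb (xl).
  by have [] := (repeats_atP _ _).1 xl.
elim: k => [_|k IH kn].
  have c0 : coboundary (0 : cfun R G n) = 0.
    by apply/funext => x; rewrite coboundaryE /altsum big1// => j _; rewrite scaler0.
  by exists 0; rewrite c0 subr0.
have [b [cb [zc zb] sb rb]] := IH (ltnW kn).
set c' := c - coboundary b in zc zb sb rb.
set b' : cfun R G n := fun y => c' (dup k y).
have cb' : cochain b' by exact: cochain_dup.
exists (b - (- (-1) ^+ k) *: b').
have -> : c - coboundary (b - - (-1) ^+ k *: b') = c' - (-1) ^+ k *: coboundary b'.
  by rewrite coboundaryB coboundaryZ scaleNr opprK opprD addrA.
split.
- exact: cochainB.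
- split; first by apply: cochainB => //; exact: cochain_coboundary.
  by rewrite coboundaryB coboundaryZ coboundary_coboundary scaler0 subr0.
- move=> x xr; rewrite [LHS](_ : _ = c' x - (-1) ^+ k * coboundary b' x)//.
  rewrite sb// coboundaryE /altsum big1 ?mulr0 ?subr0// => j _.
  by rewrite /b' sb ?scaler0//; apply: small_dup; exact: small_face.
- by apply: normalise_step.
Qed.

End Normalisation.

(** * Finite-dimensional quotients *)

Section FiniteDimension.
Variables (R : realType) (V : lmodType R).

(** By induction: passing from Z to the kernel of one functional on Z lowers the
    dimension by at most one. *)
Lemma finite_dim_quotient_functionals (I : eqType) (ev : I -> V -> R)
    (L : seq I) (Z B : set V) :
  (forall i a u v, ev i (a *: u + v) = a * ev i u + ev i v) ->
  (forall a u v, Z u -> Z v -> Z (a *: u + v)) ->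
  (forall z, Z z -> (forall i, i \in L -> ev i z = 0) -> B z) ->
  finite_dim_quotient Z B.
Proof.
move=> evl; elim: L Z => [|i L IH] Z Zl ZB.
  exists 0%N, (fun _ => 0); split=> [[]//|z Zz]; exists (fun _ => 0).
  by rewrite big_ord0 subr0; apply: ZB.
have [[e0 Ze0 fe0]|noe] := pselect (exists2 e, Z e & ev i e != 0); last first.
  apply: IH => // z Zz zL; apply: ZB => // j; rewrite inE => /orP[/eqP ->|/zL//].
  by apply/eqP/negPn/negP => fz; apply: noe; exists z.
have [m [e [Ze sp]]] : finite_dim_quotient (Z `&` [set z | ev i z = 0]) B.
  apply: IH => [a u v [Zu fu] [Zv fv]|z [Zz fz] zL].
    by split; [exact: Zl|rewrite /= evl fu fv mulr0 addr0].
  by apply: ZB => // j; rewrite inE => /orP[/eqP ->|/zL].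
exists m.+1, (fun j => if unlift ord0 j is Some k then e k else e0); split.
  by move=> j; case: unliftP => [k _|_]//; case: (Ze k).
move=> z Zz; pose a := - (ev i z / ev i e0).
have [|c Bc] := sp (a *: e0 + z).
  by split; [exact: Zl|rewrite /= evl /a mulNr divfK// addNr].
exists (fun j => if unlift ord0 j is Some k then c k else - a).
rewrite big_ord_recl unlift_none.
under eq_bigr do rewrite liftK.
by rewrite opprD scaleNr opprK addrA (addrC z).
Qed.

End FiniteDimension.

(** * Decay conditions *)

Section Decay.
Variable R : realType.

Definition gnorm (I : choiceType) (L : I -> nat) (w : nat -> R) (f : I -> R) :
    \bar R :=
  \esum_(i in [set: I]) (`|f i| * w (L i))%:E.

Definition poly_weight (k : nat) (m : nat) : R := m.+1%:R ^+ k.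
Definition exp_weight (a : R) (m : nat) : R := a ^+ m.

(** The common form of finiteness and of boundedness, which allows to treat the
    three decay conditions at once. *)
Definition for_weights (T : decay) (P : (nat -> R) -> Prop) : Prop :=
  match T with
  | Sinfty => forall k : nat, P (poly_weight k)
  | Somega => exists2 a : R, 1 < a & P (exp_weight a)
  | Ospace => forall a : R, 1 < a -> P (exp_weight a)
  end.

Lemma temperedE (G : groupType) (S : seq G) T (phi : G -> R) :
  tempered S T phi =
  for_weights T (fun w => gnorm (word_length S) w phi < +oo)%E.
Proof. by case: T. Qed.

Lemma tempered_boundedE (G : groupType) (S : seq G) T (A : set (G -> R)) :
  tempered_bounded S T A =
  for_weights T (fun w => norm_bounded (gnorm (word_length S) w) A).
Proof. by case: T. Qed.

Record length_weight (w : nat -> R) : Prop := LengthWeight {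
  weight_ge1 : forall m, 1 <= w m;
  weight_le : forall m n, (m <= n)%N -> w m <= w n;
  weightM : forall m n, w (m + n)%N <= w m * w n }.

Lemma poly_length_weight k : length_weight (poly_weight k).
Proof.
split=> [m|m n mn|m n]; rewrite /poly_weight.
- by rewrite exprn_ege1// ler1n.
- by rewrite lerXn2r ?nnegrE ?ler0n// ler_nat.
- by rewrite -exprMn lerXn2r ?nnegrE ?mulr_ge0 ?ler0n// -natrM ler_nat; lia.
Qed.

Lemma exp_length_weight a : 1 < a -> length_weight (exp_weight a).
Proof.
move=> a1; split=> [m|m n mn|m n]; rewrite /exp_weight.
- by rewrite exprn_ege1// ltW.
- by rewrite ler_weXn2l// ltW.
- by rewrite exprD.
Qed.

(** Bernoulli's inequality for the powers of b / a. *)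
Lemma exp_absorbs_linear (a b : R) : 1 < a -> a < b ->
  exists2 M : R, 0 <= M & forall m, m.+1%:R * a ^+ m <= M * b ^+ m.
Proof.
move=> a1 ab; have a0 : 0 < a by lra.
pose e := (b - a) / a; have e0 : 0 < e by rewrite divr_gt0// subr_gt0.
have e0' := ltW e0; have i0 : 0 <= e^-1 by rewrite invr_ge0.
have bE : b = a * (1 + e) by rewrite mulrDr mulr1 mulrC divfK ?gt_eqF//; lra.
have bern m : 1 + m%:R * e <= (1 + e) ^+ m.
  elim: m => [|m IH]; first by rewrite mul0r addr0 expr0.
  rewrite exprS; apply: (@le_trans _ _ ((1 + e) * (1 + m%:R * e))).
    rewrite -natr1; have : 0 <= m%:R * e * e by do 2?[apply: mulr_ge0 => //].
    lra.
  by rewrite ler_pM2l//; lra.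
exists (1 + e^-1); first by rewrite addr_ge0.
move=> m; rewrite bE exprMn mulrCA [leLHS]mulrC ler_pM2l ?exprn_gt0//.
apply: (@le_trans _ _ ((1 + e^-1) * (1 + m%:R * e))).
  rewrite mulrDl mul1r mulrDr mulr1 (mulrC m%:R) mulKf ?gt_eqF//.
  have : 0 <= e * m%:R by rewrite mulr_ge0.
  by rewrite -natr1; lra.
by rewrite ler_pM2l//; lra.
Qed.

(** The common ground of the three decay conditions: up to changing the weight,
    they allow a loss of one linear factor in the length. *)
Lemma for_weights_shift T (P Q : (nat -> R) -> Prop) :
  (forall w w' M, length_weight w -> length_weight w' -> 0 <= M ->
    (forall m, m.+1%:R * w m <= M * w' m) -> P w' -> Q w) ->
  for_weights T P -> for_weights T Q.
Proof.
move=> PQ; case: T => /=.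
- move=> Pw k; apply: (PQ _ (poly_weight k.+1) 1) (Pw k.+1) => //.
  + exact: poly_length_weight.
  + exact: poly_length_weight.
  + by move=> m; rewrite mul1r /poly_weight exprS.
- move=> [b b1 Pb]; pose a := (1 + b) / 2.
  have a1 : 1 < a by rewrite /a; lra.
  have ab : a < b by rewrite /a; lra.
  have [M M0 ME] := exp_absorbs_linear a1 ab.
  exists a => //; apply: (PQ _ (exp_weight b) M) => //; exact: exp_length_weight.
- move=> Pw a a1; have ab : a < 2 * a by lra.
  have b1 := lt_trans a1 ab.
  have [M M0 ME] := exp_absorbs_linear a1 ab.
  apply: (PQ _ (exp_weight (2 * a)) M) => //; try exact: exp_length_weight.
  exact: Pw.
Qed.

Lemma for_weights_mono T (P Q : (nat -> R) -> Prop) :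
  (forall w, length_weight w -> P w -> Q w) ->
  for_weights T P -> for_weights T Q.
Proof.
move=> PQ; case: T => /= [Pk k|[a a1 Pa]|Pk a a1].
- by apply: PQ (Pk k); exact: poly_length_weight.
- by exists a => //; apply: PQ Pa; exact: exp_length_weight.
- by apply: PQ (Pk a a1); exact: exp_length_weight.
Qed.

Lemma for_weights_and T (P Q : (nat -> R) -> Prop) :
  (forall w w', (forall m, 0 <= w m <= w' m) -> P w' -> P w) ->
  (forall w w', (forall m, 0 <= w m <= w' m) -> Q w' -> Q w) ->
  for_weights T P -> for_weights T Q ->
  for_weights T (fun w => P w /\ Q w).
Proof.
move=> Pd Qd; case: T => /= [Pk Qk k|[a a1 Pa] [b b1 Qb]|Pk Qk a a1].
- by split.
- have mono (x y : R) : 1 < x -> x <= y -> forall m, 0 <= exp_weight x m <= exp_weight y m.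
    move=> x1 xy m; rewrite /exp_weight exprn_ge0 ?lerXn2r ?nnegrE//; lra.
  have [ab|ba] := leP a b; [exists a => //; split|exists b => //; split] => //.
    exact: Qd (mono _ _ a1 ab) Qb.
  exact: Pd (mono _ _ b1 (ltW ba)) Pa.
- by split; [exact: Pk|exact: Qk].
Qed.

Lemma for_weights_ex T (P : (nat -> R) -> Prop) :
  for_weights T P -> exists2 w, length_weight w & P w.
Proof.
case: T => /= [Pk|[a a1 Pa]|Pk].
- by exists (poly_weight 0); [exact: poly_length_weight|].
- by exists (exp_weight a); [exact: exp_length_weight|].
- by exists (exp_weight 2); [apply: exp_length_weight|apply: Pk]; lra.
Qed.

(** Polynomial weights are dominated by exponential ones. *)
Lemma for_weights_exp T (P : (nat -> R) -> Prop) :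
  (forall w w', (forall m, 0 <= w m <= w' m) -> P w' -> P w) ->
  (forall a, 1 < a -> P (exp_weight a)) -> for_weights T P.
Proof.
move=> Pd Pe; case: T => //= [k|]; last by exists 2; [lra|apply: Pe; lra].
have lt1 : 1 < (2 ^+ k.+1 : R) by rewrite exprn_egt1//; lra.
apply: Pd (Pe _ lt1) => m; rewrite /poly_weight /exp_weight exprn_ge0 ?ler0n//=.
rewrite exprAC; apply: (@le_trans _ _ ((2 ^+ m) ^+ k)).
  by rewrite lerXn2r ?nnegrE ?exprn_ge0 ?ler0n// -natrX ler_nat ltn_expl.
by rewrite ler_weXn2l// exprn_ege1//; lra.
Qed.

Section Norms.
Variables (I : choiceType) (L : I -> nat).
Implicit Types (f g : I -> R) (w : nat -> R).

Lemma gnorm_le_scale w w' (M : R) f g : 0 <= M ->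
  (forall i, 0 <= `|g i| * w' (L i)) ->
  (forall i, `|f i| * w (L i) <= M * (`|g i| * w' (L i))) ->
  (gnorm L w f <= M%:E * gnorm L w' g)%E.
Proof.
move=> M0 g0 fg; apply: ge_ereal_sup => _ [X [finX _]] <-.
apply: (@le_trans _ _ (M%:E * \sum_(i \in X) (`|g i| * w' (L i))%R%:E)%E); last first.
  by rewrite lee_wpmul2l ?lee_fin//; apply: ereal_sup_ubound; exists X.
rewrite !fsbig_finite//= !sumEFin -EFinM lee_fin mulr_sumr.
by apply: ler_sum.
Qed.

Lemma gnorm_ge w f i : (forall m, 0 <= w m) ->
  ((`|f i| * w (L i))%R%:E <= gnorm L w f)%E.
Proof.
move=> w0; rewrite -(@esum_set1 _ _ i (fun i => (`|f i| * w (L i))%:E)).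
  rewrite esum_mkcond; apply: le_esum => j _; case: ifP => // _.
  by rewrite lee_fin mulr_ge0.
by rewrite lee_fin mulr_ge0.
Qed.

Lemma gnorm_le w f g : (forall m, 0 <= w m) ->
  (forall i, `|f i| <= `|g i|) -> (gnorm L w f <= gnorm L w g)%E.
Proof. by move=> w0 fg; apply: le_esum => i _; rewrite lee_fin ler_wpM2r. Qed.

Lemma gnorm_weight_le w w' f : (forall m, 0 <= w m <= w' m) ->
  (gnorm L w f <= gnorm L w' f)%E.
Proof.
move=> ww; apply: le_esum => i _; rewrite lee_fin ler_wpM2l//.
by have /andP[] := ww (L i).
Qed.

Lemma gnormD w f g : (forall m, 0 <= w m) ->
  (gnorm L w (fun i => f i + g i)%R <= gnorm L w f + gnorm L w g)%E.
Proof.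
move=> w0; rewrite /gnorm -esumD => [|i _|i _]; rewrite ?lee_fin ?mulr_ge0//.
by apply: le_esum => i _; rewrite -EFinD lee_fin -mulrDl ler_wpM2r// ler_normD.
Qed.

Lemma gnorm_single w f i : (forall m, 0 <= w m) ->
  (forall j, j <> i -> f j = 0) -> gnorm L w f = (`|f i| * w (L i))%:E.
Proof.
move=> w0 fi; rewrite /gnorm (@esum_single _ _ (fun j => `|f j| * w (L j)) i)//.
  by move=> j; rewrite mulr_ge0.
by move=> j ji; rewrite fi// normr0 mul0r.
Qed.

Variable T : decay.

Definition decaying f : Prop := for_weights T (fun w => gnorm L w f < +oo)%E.

Definition decay_bounded (A : set (I -> R)) : Prop :=
  for_weights T (fun w => exists M : R, forall g, A g -> (gnorm L w g <= M%:E)%E).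

Lemma decaying_summable f : decaying f -> abs_summable f.
Proof.
move=> /for_weights_ex[w wl]; apply: le_lt_trans; apply: le_esum => i _.
by rewrite lee_fin ler_peMr//; exact: weight_ge1.
Qed.

Lemma decaying_length_mul f g :
  (forall i, `|f i| <= (L i).+1%:R * `|g i|) -> decaying g -> decaying f.
Proof.
move=> fg; apply: for_weights_shift => w w' M wl wl' M0 ww' gf.
have w0 m : 0 <= w m := le_trans ler01 (weight_ge1 wl m).
have w0' m : 0 <= w' m := le_trans ler01 (weight_ge1 wl' m).
apply: (@le_lt_trans _ _ (M%:E * gnorm L w' g)%E).
  apply: gnorm_le_scale => // i; first by rewrite mulr_ge0.
  apply: (@le_trans _ _ ((L i).+1%:R * `|g i| * w (L i))); first by rewrite ler_wpM2r.
  by rewrite mulrAC [leLHS]mulrC [leRHS]mulrCA ler_wpM2l.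
have gE : gnorm L w' g \is a fin_num.
  by rewrite ge0_fin_numE//; apply: esum_ge0R => i; rewrite mulr_ge0.
by rewrite -(fineK gE) -EFinM ltry.
Qed.

Lemma decaying_le f g : (forall i, `|f i| <= `|g i|) -> decaying g -> decaying f.
Proof.
move=> fg; apply: decaying_length_mul => i; apply: le_trans (fg i) _.
by rewrite ler_peMl// ler1n.
Qed.

Lemma decayingZ (a : R) f : decaying f -> decaying (fun i => a * f i).
Proof.
apply: for_weights_shift => w w' M wl wl' M0 ww' gf.
have w0 m : 0 <= w m := le_trans ler01 (weight_ge1 wl m).
have w0' m : 0 <= w' m := le_trans ler01 (weight_ge1 wl' m).
apply: (@le_lt_trans _ _ ((`|a| * M)%:E * gnorm L w' f)%E).
  apply: gnorm_le_scale; first by rewrite mulr_ge0.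
    by move=> i; rewrite mulr_ge0.
  move=> i; rewrite normrM -!mulrA ler_wpM2l// mulrCA ler_wpM2l//.
  by apply: le_trans (ww' _); rewrite ler_peMl// ler1n.
have gE : gnorm L w' f \is a fin_num.
  by rewrite ge0_fin_numE//; apply: esum_ge0R => i; rewrite mulr_ge0.
by rewrite -(fineK gE) -EFinM ltry.
Qed.

Lemma decayingD f g : decaying f -> decaying g -> decaying (fun i => f i + g i).
Proof.
move=> df dg.
have dn (k : I -> R) w w' : (forall m, 0 <= w m <= w' m) ->
    (gnorm L w' k < +oo)%E -> (gnorm L w k < +oo)%E.
  by move=> ww'; apply: le_lt_trans; exact: gnorm_weight_le.
have := for_weights_and (dn f) (dn g) df dg.
apply: for_weights_mono => w wl [ff gf].
have w0 m : 0 <= w m := le_trans ler01 (weight_ge1 wl m).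
by apply: le_lt_trans (gnormD _ _ w0) _; rewrite lte_add_pinfty.
Qed.

Lemma decaying_dominates f (A : set (I -> R)) :
  (forall g, A g -> forall i, `|g i| <= `|f i|) -> decaying f ->
  decay_bounded A.
Proof.
move=> Af; apply: for_weights_mono => w wl ff.
have w0 m : 0 <= w m := le_trans ler01 (weight_ge1 wl m).
have gE : gnorm L w f \is a fin_num.
  by rewrite ge0_fin_numE//; apply: esum_ge0R => i; rewrite mulr_ge0.
exists (fine (gnorm L w f)) => g Ag; rewrite fineK//; apply: gnorm_le => //.
exact: Af.
Qed.

(** For translations in the group, which change the length by a bounded amount;
    the submultiplicativity of the weights absorbs this change. *)
Lemma decaying_reindex (e : I -> I) C f : bijective e ->
  (forall i, (L i <= C + L (e i))%N) -> decaying f -> decaying (f \o e).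
Proof.
move=> eb eL; apply: for_weights_mono => w wl ff.
have w0 m : 0 <= w m := le_trans ler01 (weight_ge1 wl m).
have gE : gnorm L w f \is a fin_num.
  by rewrite ge0_fin_numE//; apply: esum_ge0R => i; rewrite mulr_ge0.
have fE : gnorm L w f = gnorm (L \o e) w (f \o e).
  by rewrite -setTT_bijective in eb; rewrite /gnorm (reindex_esum _ _ _ _ eb).
apply: (@le_lt_trans _ _ ((w C)%:E * gnorm (L \o e) w (f \o e))%E); last first.
  by rewrite -fE -(fineK gE) -EFinM ltry.
apply: ge_ereal_sup => _ [X [finX _]] <-.
apply: (@le_trans _ _
  ((w C)%:E * \sum_(i \in X) (`|f (e i)| * w (L (e i)))%R%:E)%E); last first.
  rewrite lee_wpmul2l ?lee_fin//; apply: ereal_sup_ubound; by exists X.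
rewrite !fsbig_finite//= !sumEFin -EFinM lee_fin mulr_sumr.
apply: ler_sum => i _; rewrite mulrCA ler_wpM2l//.
by apply: le_trans (weightM wl _ _); exact: weight_le.
Qed.

End Norms.
End Decay.

(** * Chains of controlled propagation *)

Section Chains.
Variables (R : realType) (G : groupType) (S : seq G) (T : decay).
Hypothesis gS : generates S.

Definition base_length (n : nat) (t : {ffun 'I_n.+1 -> G}) : nat :=
  word_length S (t ord0).

Lemma not_smallP r n (x : {ffun 'I_n.+1 -> G}) :
  ~ small S r x <-> exists i j, (r < word_dist S (x i) (x j))%N.
Proof.
split=> [ns|[i [j ij]] sm]; last by move: (sm i j); lia.
apply: contrapT => nex; apply: ns => i j; rewrite leqNgt; apply/negP => ij.
by apply: nex; exists i, j.
Qed.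

Lemma finite_row r n (phi : cfun R G n) (x : G) :
  (forall t, ~ small S r t -> phi t = 0) ->
  finite_set ([set t : {ffun 'I_n.+1 -> G} | t ord0 = x] `&`
    (fun t => `|phi t|) @^-1` [set~ 0]).
Proof.
move=> sp; apply: sub_finite_set (finite_small_at gS r ord0 (finite_set1 x)).
move=> t [tx] /= pt; split=> //; apply: contrapT => /sp pt0.
by apply: pt; rewrite pt0 normr0.
Qed.

(** Finite propagation makes the sums in [row_norm] finite, so that summing row
    by row amounts to summing over all tuples. *)
Lemma gnorm_row_norm r n (phi : cfun R G n) (w : nat -> R) :
  (forall t, ~ small S r t -> phi t = 0) -> (forall m, 0 <= w m) ->
  gnorm (word_length S) w (row_norm phi) = gnorm (@base_length n) w phi.
Proof.
move=> sp w0; rewrite /gnorm.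
rewrite -(esum_fibres (fun t : {ffun 'I_n.+1 -> G} => t ord0)); last first.
  by move=> t; rewrite mulr_ge0.
apply: eq_esum => x _; rewrite ger0_norm; last by apply: fsumr_ge0.
have fin := finite_row x sp.
rewrite /row_norm fsbig_supp /= mulr_fsuml fsbig_finite//= -sumEFin -fsbig_finite//.
rewrite -esum_fset//; last by move=> t _; rewrite lee_fin mulr_ge0.
rewrite esum_mkcondr; apply: eq_esum => t /= tx.
rewrite /base_length tx; case: ifPn => // /negP; rewrite inE /= => /contrapT ->.
by rewrite mul0r.
Qed.

Lemma norm_row_norm r n (phi : cfun R G n) t :
  (forall t, ~ small S r t -> phi t = 0) -> `|phi t| <= row_norm phi (t ord0).
Proof.
move=> sp; have [->|p0] := eqVneq (`|phi t|) 0; first exact: fsumr_ge0.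
rewrite /row_norm fsbig_supp /= (fsbigD1 t)/=; [|exact: finite_row sp|].
  by rewrite lerDl; apply: fsumr_ge0.
by split=> //; apply/eqP.
Qed.

Lemma chain_rP r n (phi : cfun R G n) : chain_r S T r phi <->
  [/\ forall t, ~ small S r t -> phi t = 0,
      forall t, degenerate t -> phi t = 0 & decaying (@base_length n) T phi].
Proof.
split=> [[h1 h2 h3]|[h1 h2 h3]].
  have sp t : ~ small S r t -> phi t = 0 by move=> /not_smallP; exact: h1.
  split=> //; move: h3; rewrite temperedE; apply: for_weights_mono => w wl.
  by rewrite (gnorm_row_norm sp)// => m; exact: le_trans ler01 (weight_ge1 wl m).
split=> //; first by move=> t /not_smallP; exact: h1.
rewrite temperedE; move: h3; apply: for_weights_mono => w wl.
by rewrite (gnorm_row_norm h1)// => m; exact: le_trans ler01 (weight_ge1 wl m).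
Qed.

Lemma chain_r_le r n (phi psi : cfun R G n) :
  (forall t, `|psi t| <= `|phi t|) -> chain_r S T r phi -> chain_r S T r psi.
Proof.
move=> le /chain_rP[h1 h2 h3]; have z t : phi t = 0 -> psi t = 0.
  by move=> p0; apply/eqP; rewrite -normr_le0 (le_trans (le t))// p0 normr0.
by apply/chain_rP; split=> [t /h1/z|t /h2/z|]//; exact: decaying_le h3.
Qed.

Lemma chain_r_widen r r' n (phi : cfun R G n) : (r <= r')%N ->
  chain_r S T r phi -> chain_r S T r' phi.
Proof.
move=> rr /chain_rP[h1 h2 h3]; apply/chain_rP; split=> // t nt; apply: h1.
by move=> /(small_le rr).
Qed.

Lemma chain_r0 r n : chain_r S T r (0 : cfun R G n).
Proof.
apply/chain_rP; split=> //; apply: for_weights_exp => [w w' ww'|a _].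
  by apply: le_lt_trans; exact: gnorm_weight_le.
by rewrite /gnorm esum1 ?ltry// => t _; rewrite normr0 mul0r.
Qed.

Lemma chain_rZD r n (a : R) (phi psi : cfun R G n) :
  chain_r S T r phi -> chain_r S T r psi -> chain_r S T r (a *: phi + psi).
Proof.
move=> /chain_rP[h1 h2 h3] /chain_rP[k1 k2 k3]; apply/chain_rP.
have E t : (a *: phi + psi) t = a * phi t + psi t by [].
split=> [t ts|t td|].
- by rewrite E h1// k1// mulr0 addr0.
- by rewrite E h2// k2// mulr0 addr0.
- by apply: decayingD => //; exact: decayingZ.
Qed.

Lemma chain_rZ r n (a : R) (phi : cfun R G n) :
  chain_r S T r phi -> chain_r S T r (a *: phi).
Proof. by move=> h; rewrite -[a *: phi]addr0; apply: chain_rZD => //; exact: chain_r0. Qed.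

Lemma chain_rB r n (phi psi : cfun R G n) :
  chain_r S T r phi -> chain_r S T r psi -> chain_r S T r (phi - psi).
Proof. by move=> hp hq; rewrite addrC -scaleN1r; exact: chain_rZD. Qed.

Lemma chain_r_sum r n k (f : 'I_k -> cfun R G n) (a : 'I_k -> R) :
  (forall i, chain_r S T r (f i)) -> chain_r S T r (\sum_(i < k) a i *: f i).
Proof.
move=> h; elim/big_ind: _ => [|x y hx hy|i _].
- exact: chain_r0.
- by rewrite -[x]scale1r; exact: chain_rZD.
- exact: chain_rZ.
Qed.

Lemma chain_r_translate r n (g : G) (phi : cfun R G n) :
  chain_r S T r phi -> chain_r S T r (phi \o translate g).
Proof.
move=> /chain_rP[h1 h2 h3]; apply/chain_rP; split=> [t ts|t td|].
- by apply: h1 => /small_translate.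
- by apply: h2; apply/degenerate_translate.
- apply: (decaying_reindex (C := word_length S g^-1%g)) => //.
    exact: translate_bij.
  move=> t; rewrite /base_length.
  have {1}-> : t ord0 = (g^-1 * translate g t ord0)%g by rewrite ffunE mulKg.
  exact: word_lengthM.
Qed.

Lemma chain_bounded_of_decay r n (A : set (cfun R G n)) :
  A `<=` @chain_r R G S T r n -> decay_bounded (@base_length n) T A ->
  chain_bounded S T A.
Proof.
move=> Ar Ab; exists r; split=> //; rewrite tempered_boundedE; move: Ab.
apply: for_weights_mono => w wl [M AM]; exists M => _ [phi Aphi <-].
have [sp _ _] := (chain_rP _ _).1 (Ar _ Aphi).
rewrite (gnorm_row_norm sp); first exact: AM.
by move=> m; exact: le_trans ler01 (weight_ge1 wl m).
Qed.

Lemma chain_bounded_pointwise n (A : set (cfun R G n)) : chain_bounded S T A ->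
  exists M : R, forall phi t, A phi -> `|phi t| <= M.
Proof.
move=> [r [Ar]]; rewrite tempered_boundedE => /for_weights_ex[w wl [M AM]].
have w0 m : 0 <= w m := le_trans ler01 (weight_ge1 wl m).
exists M => phi t Aphi; have [sp _ _] := (chain_rP _ _).1 (Ar _ Aphi).
apply: le_trans (norm_row_norm t sp) _; rewrite -lee_fin.
apply: le_trans (AM _ (ex_intro2 _ _ phi Aphi erefl)).
apply: le_trans (gnorm_ge _ _ (t ord0) w0); rewrite lee_fin.
by rewrite (le_trans (ler_norm _))// ler_peMr// weight_ge1.
Qed.

Definition delta n (x : {ffun 'I_n.+1 -> G}) : cfun R G n := fun z => (z == x)%:R.

Lemma gnorm_delta n (x : {ffun 'I_n.+1 -> G}) w : (forall m, 0 <= w m) ->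
  gnorm (@base_length n) w (delta x) = (w (base_length x))%:E.
Proof.
move=> w0; rewrite (@gnorm_single _ _ _ _ _ x)//.
  by rewrite /delta eqxx normr1 mul1r.
by move=> j /eqP/negPf jx; rewrite /delta jx.
Qed.

Lemma chain_r_delta r n (x : {ffun 'I_n.+1 -> G}) : small S r x ->
  ~ degenerate x -> chain_r S T r (delta x).
Proof.
move=> xr xd; apply/chain_rP; split=> [t ts|t td|].
- by rewrite /delta; case: eqP => // tx; case: ts; rewrite tx.
- by rewrite /delta; case: eqP => // tx; case: xd; rewrite -tx.
- apply: for_weights_exp => [w w' ww'|a a1].
    by apply: le_lt_trans; exact: gnorm_weight_le.
  by rewrite gnorm_delta ?ltry// => m; rewrite exprn_ge0//; lra.
Qed.

End Chains.

(** * Bounded maps between chain spaces control propagation uniformly *)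

Section UniformPropagation.
Variables (R : realType) (G : groupType) (S : seq G) (T : decay).
Hypothesis gS : generates S.

(** From an integer Q above a onwards, the quotient of a ^+ p by the factorial of
    p decreases. *)
Lemma exp_le_factorial (a : R) : 1 < a ->
  exists2 M : R, 0 <= M & forall p, a ^+ p <= M * p`!%:R.
Proof.
move=> a1; have a0 : 0 <= a by lra.
have [Q aQ] : exists Q : nat, a <= Q%:R.
  by exists (Num.bound a); apply/ltW; exact: archi_boundP.
exists (a ^+ Q); first exact: exprn_ge0.
elim=> [|p IH]; first by rewrite fact0 mulr1 exprn_ege1// ltW.
rewrite factS natrM; have [pQ|Qp] := ltnP p Q.
  rewrite (@le_trans _ _ (a ^+ Q))//; first by rewrite ler_weXn2l// ltW.
  by rewrite ler_peMr ?exprn_ge0// -natrM ler1n -factS fact_gt0.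
rewrite exprS mulrCA; apply: ler_pM => //; first exact: exprn_ge0.
by rewrite (le_trans aQ)// ler_nat; lia.
Qed.

Section BoundedMap.
Variables (n : nat) (h : cfun R G n -> cfun R G n.+1).
Hypothesis hb : bounded_linear_map (@reduced_chain R G S T n)
  (@chain_bounded R G S T n) (@reduced_chain R G S T n.+1)
  (@chain_bounded R G S T n.+1) h.

Lemma bounded_linear_scale (a : R) phi : (forall b : R, reduced_chain S T (b *: phi)) ->
  h (a *: phi) = a *: h phi.
Proof.
move=> C; have [_ lin _] := hb.
have C0 : reduced_chain S T (0 : cfun R G n) by rewrite -(scale0r phi); exact: C.
have h0 : h 0 = 0.
  have := lin 1 _ _ C0 C0; rewrite scaler0 scale1r addr0 => /eqP.
  by rewrite -subr_eq subrr => /eqP <-.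
have Cp : reduced_chain S T phi by rewrite -[phi]scale1r; exact: C.
by have := lin a _ _ Cp C0; rewrite h0 !addr0.
Qed.

(** Scaling by inverse factorials, which decay faster than all weights grow,
    turns the family into a bounded set; scaling does not affect propagation. *)
Lemma uniform_propagation_family r (B : set (cfun R G n)) :
  (forall phi, B phi -> [/\ forall a : R, reduced_chain S T (a *: phi),
     chain_r S T r phi & exists p : nat, forall a : R, 1 < a ->
       (gnorm (@base_length G S n) (exp_weight a) phi <= (2 * a ^+ p)%:E)%E]) ->
  exists r', forall phi, B phi -> chain_r S T r' (h phi).
Proof.
move=> HB.
pose A := [set psi : cfun R G n | exists (phi : cfun R G n) (p : nat),
  [/\ B phi, psi = (p`!%:R^-1 : R) *: phi & forall a : R, 1 < a ->
       (gnorm (@base_length G S n) (exp_weight a) phi <= (2 * a ^+ p)%:E)%E]].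
have [_ _ hA] := hb.
have [r' [r'A _]] : chain_bounded S T (h @` A).
  apply: hA; first by move=> _ [phi [p [Bphi -> _]]]; have [] := HB _ Bphi.
  apply: (@chain_bounded_of_decay _ _ _ _ gS r).
    move=> _ [phi [p [Bphi -> _]]]; have [_ cr _] := HB _ Bphi; exact: chain_rZ.
  apply: for_weights_exp => [w w' ww' [M AM]|a a1].
    by exists M => psi Apsi; apply: le_trans (AM _ Apsi); exact: gnorm_weight_le.
  have a0 : 0 <= a by lra.
  have [M M0 aM] := exp_le_factorial a1.
  exists (2 * M) => _ [phi [p [Bphi -> np]]].
  have f0 : 0 < p`!%:R :> R by rewrite ltr0n fact_gt0.
  apply: (@le_trans _ _ ((p`!%:R^-1)%:E * gnorm (@base_length G S n) (exp_weight a) phi)%E).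
    apply: gnorm_le_scale; first by rewrite invr_ge0 ltW.
      by move=> t; rewrite mulr_ge0 ?exprn_ge0.
    move=> t; rewrite [(_ *: phi) t](_ : _ = p`!%:R^-1 * phi t)//.
    by rewrite normrM -mulrA ger0_norm// invr_ge0 ltW.
  apply: (@le_trans _ _ ((p`!%:R^-1)%:E * (2 * a ^+ p)%:E)%E).
    by rewrite lee_wpmul2l ?lee_fin ?invr_ge0 ?(ltW f0)//; exact: np.
  by rewrite -EFinM lee_fin mulrC ler_pdivrMr// -mulrA ler_pM2l//; exact: aM.
exists r' => phi Bphi; have [Ca cr [p np]] := HB _ Bphi.
have := r'A (h ((p`!%:R^-1 : R) *: phi)); rewrite bounded_linear_scale//.
move=> /(_ _)/(chain_rZ gS (p`!%:R : R)); rewrite scalerA mulfV ?scale1r; last first.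
  by rewrite pnatr_eq0 -lt0n fact_gt0.
apply; exists ((p`!%:R^-1 : R) *: phi); last by rewrite bounded_linear_scale.
by exists phi, p.
Qed.

End BoundedMap.

Lemma augmentation_deltaB (a : R) (x y : {ffun 'I_1 -> G}) :
  augmentation (a *: (delta R x - delta R y)) = 0.
Proof.
have d (b : R) (z : {ffun 'I_1 -> G}) : (forall j, j <> z -> b * delta R z j = 0).
  by move=> j /eqP/negPf jz; rewrite /delta jz mulr0.
rewrite /augmentation.
have -> : a *: (delta R x - delta R y) =
    (fun z => a * delta R x z + (- a) * delta R y z : R^o).
  apply/funext => z; rewrite [LHS](_ : _ = a * (delta R x z - delta R y z))//.
  by rewrite mulrBr mulNr.
rewrite rsumD; [|exact: abs_summable_single (d _ _)..].
by rewrite !(rsum_single (d _ _)) /delta !eqxx !mulr1 subrr.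
Qed.

Lemma nondegenerate_vertex (x : {ffun 'I_1 -> G}) : ~ degenerate x.
Proof. by move=> [i [j [ij _]]]; have := ltn_ord j; rewrite ij. Qed.

Lemma small_vertex (x : {ffun 'I_1 -> G}) : small S 0 x.
Proof. by move=> i j; rewrite !ord1 /word_dist mulVg word_length1. Qed.

(** In degree 0, [chain_map] applies the contraction only to differences of two
    vertices, whose augmentation vanishes. *)
Lemma uniform_propagation0 (h : cfun R G 0 -> cfun R G 1) :
  bounded_linear_map (@reduced_chain R G S T 0) (@chain_bounded R G S T 0)
    (@reduced_chain R G S T 1) (@chain_bounded R G S T 1) h ->
  exists r', forall x y, chain_r S T r' (h (delta R x - delta R y)).
Proof.
move=> hb; pose B := [set phi | exists x y : {ffun 'I_1 -> G}, phi = delta R x - delta R y].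
have [|r' r'B] := uniform_propagation_family hb (r := 0) (B := B).
  move=> _ [x [y ->]].
  have cr : chain_r S T 0 (delta R x - delta R y).
    by apply: chain_rB => //; apply: chain_r_delta => //;
      (exact: small_vertex || exact: nondegenerate_vertex).
  split=> //.
    by move=> a; split; [exists 0%N; exact: chain_rZ|exact: augmentation_deltaB].
  exists (maxn (base_length S x) (base_length S y)) => a a1.
  have w0 m : 0 <= exp_weight a m by rewrite exprn_ge0//; lra.
  have le z m : (base_length S z <= m)%N ->
      exp_weight a (base_length S z) <= a ^+ m.
    by move=> zm; rewrite ler_weXn2l// ltW.
  have -> : delta R x - delta R y = (fun t => delta R x t + (-1) * delta R y t).
    by apply/funext => t; rewrite mulN1r.
  apply: le_trans (gnormD _ _ _ w0) _.
  rewrite mulr_natl mulr2n EFinD; apply: leeD.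
    by rewrite gnorm_delta// lee_fin le ?leq_maxl.
  apply: (@le_trans _ _ (gnorm (base_length S (n:=0)) (exp_weight a) (delta R y))).
    by apply: gnorm_le => // t; rewrite mulN1r normrN.
  by rewrite gnorm_delta// lee_fin le ?leq_maxr.
by exists r' => x y; apply: r'B; exists x, y.
Qed.

(** Characteristic functions are handled by [uniform_propagation_family], hence
    all finitely supported chains. For a general chain, the parts outside the
    ball of radius N, multiplied by N+1, form a bounded set, since they are
    dominated by the chain multiplied by the length function. Their images are
    bounded, so the part of the image that exceeds the uniform propagation is
    bounded by a constant over N+1 for all N. *)
Lemma uniform_propagation n (h : cfun R G n.+1 -> cfun R G n.+2) :
  bounded_linear_map (@reduced_chain R G S T n.+1) (@chain_bounded R G S T n.+1)
    (@reduced_chain R G S T n.+2) (@chain_bounded R G S T n.+2) h ->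
  forall r, exists r', forall phi, chain_r S T r phi -> chain_r S T r' (h phi).
Proof.
move=> hb r; have [hC lin hA] := hb.
have CP s (phi : cfun R G n.+1) : chain_r S T s phi -> reduced_chain S T phi by exists s.
have h0 : h 0 = 0.
  by rewrite -(scale0r (0 : cfun R G n.+1)) (bounded_linear_scale hb) ?scale0r// => b;
    rewrite scaler0; apply: (CP 0%N); exact: chain_r0.
pose B := [set phi | exists x : {ffun 'I_n.+2 -> G},
  [/\ small S r x, ~ degenerate x & phi = delta R x]].
have [|r' r'B] := uniform_propagation_family hb (r := r) (B := B).
  move=> _ [x [xr xd ->]]; have cr : chain_r S T r (delta R x) by exact: chain_r_delta.
  split=> //; first by move=> a; apply: (CP r); exact: chain_rZ.
  exists (base_length S x) => a a1; rewrite gnorm_delta; last first.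
    by move=> m; rewrite exprn_ge0//; lra.
  by rewrite lee_fin ler_peMl ?exprn_ge0//; lra.
have off phi (s : seq {ffun 'I_n.+2 -> G}) : chain_r S T r phi ->
    (forall t, t \notin s -> phi t = 0) -> forall x, ~ small S r' x -> h phi x = 0.
  elim: s phi => [|t s IH] phi cphi supp x xr'.
    have -> : phi = 0 by apply/funext => u; exact: supp.
    by rewrite h0.
  pose phi' : cfun R G n.+1 := fun u => if u == t then 0 else phi u.
  have cphi' : chain_r S T r phi'.
    by apply: chain_r_le cphi => // u; rewrite /phi'; case: ifP => // _; rewrite normr0.
  have phi'0 : h phi' x = 0.
    apply: IH => // u us; rewrite /phi'; case: ifPn => // ut.
    by apply: supp; rewrite inE (negPf ut).
  have [pt0|pt0] := eqVneq (phi t) 0.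
    have -> // : phi = phi'.
    by apply/funext => u; rewrite /phi'; case: eqP => // ->.
  have [sp dg _] := (chain_rP _ gS _ _).1 cphi.
  have tr : small S r t by apply: contrapT => /sp pt; rewrite pt eqxx in pt0.
  have td : ~ degenerate t by move=> /dg pt; rewrite pt eqxx in pt0.
  have -> : phi = phi t *: delta R t + phi'.
    apply/funext => u; rewrite [RHS](_ : _ = phi t * delta R t u + phi' u)//.
    rewrite /delta /phi'; case: eqP => [->|_]; first by rewrite mulr1 addr0.
    by rewrite mulr0 add0r.
  rewrite lin; [|apply: (CP r); exact: chain_r_delta|exact: (CP r)].
  rewrite [LHS](_ : _ = phi t * h (delta R t) x + h phi' x)// phi'0 addr0.
  have [sp' _ _] := (chain_rP _ gS _ _).1 (r'B (delta R t) (ex_intro _ t (And3 tr td erefl))).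
  by rewrite sp'// mulr0.
exists r' => phi cphi; have [sp dg dphi] := (chain_rP _ gS _ _).1 cphi.
pose inner N : cfun R G n.+1 := fun t => if (base_length S t <= N)%N then phi t else 0.
pose outer N : cfun R G n.+1 := fun t => if (base_length S t <= N)%N then 0 else phi t.
have phiE N : phi = inner N + outer N.
  apply/funext => t; rewrite [RHS](_ : _ = inner N t + outer N t)// /inner /outer.
  by case: ifP => _; rewrite ?addr0 ?add0r.
have cin N : chain_r S T r (inner N).
  by apply: chain_r_le cphi => // t; rewrite /inner; case: ifP => // _; rewrite normr0.
have cout N : chain_r S T r (outer N).
  by apply: chain_r_le cphi => // t; rewrite /outer; case: ifP => // _; rewrite normr0.
pose A := [set psi | exists N : nat, psi = (N.+1%:R : R) *: outer N].
have Ab : chain_bounded S T A.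
  apply: (@chain_bounded_of_decay _ _ _ _ gS r) => [_ [N ->]|]; first exact: chain_rZ.
  apply: (@decaying_dominates _ _ _ _ (fun t => (base_length S t).+1%:R * phi t)).
    move=> _ [N ->] t; rewrite [(_ *: _) t](_ : _ = N.+1%:R * outer N t)//.
    rewrite /outer; case: leqP => [_|Nt]; first by rewrite mulr0 normr0.
    by rewrite !normrM ler_wpM2r// !ger0_norm// ler_nat; lia.
  apply: decaying_length_mul dphi => t.
  by rewrite normrM ger0_norm.
have AC : A `<=` @reduced_chain R G S T n.+1.
  by move=> _ [N ->]; apply: (CP r); exact: chain_rZ.
have [M MA] := chain_bounded_pointwise gS (hA _ AC Ab).
have [r1 cr1] : reduced_chain S T (h phi) by apply: hC; exact: (CP r).
have [_ dg1 d1] := (chain_rP _ gS _ _).1 cr1.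
apply/(chain_rP _ gS); split=> // x xr'; apply/eqP/negPn/negP => hx.
have bound N : N.+1%:R * `|h phi x| <= M.
  have -> : N.+1%:R * `|h phi x| = `|h ((N.+1%:R : R) *: outer N) x|.
    rewrite (bounded_linear_scale hb); last by move=> b; apply: (CP r); exact: chain_rZ.
    rewrite [X in _ = `|X|](_ : _ = N.+1%:R * h (outer N) x)// normrM ger0_norm//.
    congr (_ * `|_|); rewrite {1}(phiE N) -[inner N]scale1r.
    rewrite lin; [|exact: (CP r)..].
    rewrite [LHS](_ : _ = 1 * h (inner N) x + h (outer N) x)// mul1r.
    have [s sE] := (finite_seqP _).1
      (finite_small_at gS r (ord0 : 'I_n.+2) (finite_ball gS N)).
    rewrite (off _ s)// ?add0r// => t ts; rewrite /inner; case: ifP => // tN.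
    apply: sp => tr; move/negP: ts; apply.
    by have : [set` s] t by rewrite -sE.
  by apply: MA; exists ((N.+1%:R : R) *: outer N) => //; exists N.
have hx0 : 0 < `|h phi x| by rewrite normr_gt0.
have := bound (Num.bound (M / `|h phi x|)).
rewrite leNgt => /negP; apply; rewrite -ltr_pdivrMr//.
apply: (@lt_le_trans _ _ (Num.bound (M / `|h phi x|))%:R); last by rewrite ler_nat.
apply: archi_boundP; rewrite divr_ge0//.
by apply: le_trans (bound 0%N); rewrite mulr_ge0.
Qed.

End UniformPropagation.

(** * The boundary map *)

Section Boundary.
Variables (R : realType) (G : groupType) (S : seq G) (T : decay).
Hypothesis gS : generates S.

Definition cofaces (r n : nat) (y : {ffun 'I_n.+1 -> G}) :
    set {ffun 'I_n.+2 -> G} :=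
  [set x | small S r x /\ exists j, face j x = y].

Lemma finite_cofaces r n (y : {ffun 'I_n.+1 -> G}) : finite_set (cofaces r y).
Proof.
apply: (@sub_finite_set _ _ (\bigcup_(j in [set: 'I_n.+2])
    [set x : {ffun 'I_n.+2 -> G} | small S r x /\ [set y ord0] (x (lift j ord0))])).
  by move=> x [xr [j <-]]; exists j => //; split=> //; rewrite /= ffunE.
apply: bigcup_finite => [|j _]; first exact: finite_finset.
by apply: finite_small_at; first exact: gS; exact: finite_set1.
Qed.

Lemma bd_tuple_eq0 n (x : {ffun 'I_n.+2 -> G}) y :
  (forall j, face j x <> y) -> bd_tuple R x y = 0.
Proof.
move=> nf; rewrite /bd_tuple; case: asboolP => // _.
by rewrite big1// => j _; case: eqP => [/nf//|_]; rewrite mulr0.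
Qed.

Lemma boundaryE r n (phi : cfun R G n.+1) y :
  (forall t, ~ small S r t -> phi t = 0) ->
  boundary phi y = \sum_(x \in cofaces r y) phi x * bd_tuple R x y.
Proof.
move=> sp; apply/esym/fsbig_widen => // x [_ /= nx].
have [xr|/sp ->] := pselect (small S r x); last by rewrite mul0r.
by rewrite bd_tuple_eq0 ?mulr0// => j jx; apply: nx; split=> //; exists j.
Qed.

Lemma chainZD n (a : R) (phi psi : cfun R G n) :
  chain S T phi -> chain S T psi -> chain S T (a *: phi + psi).
Proof.
move=> [r hr] [s hs]; exists (maxn r s).
by apply: (chain_rZD gS); [apply: chain_r_widen hr|apply: chain_r_widen hs];
  rewrite ?leq_maxl ?leq_maxr.
Qed.

Lemma chain0 n : chain S T (0 : cfun R G n).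
Proof. by exists 0%N; exact: chain_r0. Qed.

Lemma boundaryZD n (a : R) (phi psi : cfun R G n.+1) :
  chain S T phi -> chain S T psi ->
  boundary (a *: phi + psi) = a *: boundary phi + boundary psi.
Proof.
move=> [r hr] [s hs]; apply/funext => y.
have sp (k : nat) (f : cfun R G n.+1) : (k <= maxn r s)%N -> chain_r S T k f ->
    forall t, ~ small S (maxn r s) t -> f t = 0.
  by move=> km /(chain_r_widen gS km)/(chain_rP _ gS)[].
have spr := sp _ _ (leq_maxl r s) hr; have sps := sp _ _ (leq_maxr r s) hs.
rewrite [RHS](_ : _ = a * boundary phi y + boundary psi y)//.
rewrite (boundaryE y spr) (boundaryE y sps) (@boundaryE (maxn r s)); last first.
  by move=> t ts; rewrite [LHS](_ : _ = a * phi t + psi t)// spr// sps// mulr0 addr0.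
rewrite !fsbig_finite//=; try exact: finite_cofaces.
rewrite mulr_sumr -big_split/=; apply: eq_bigr => x _.
by rewrite [(_ + _) x](_ : _ = a * phi x + psi x)// mulrDl mulrA.
Qed.

Lemma boundary0 n : boundary (0 : cfun R G n.+1) = 0.
Proof.
by apply/funext => y; rewrite /boundary fsbig1// => x _; rewrite mul0r.
Qed.

Lemma boundaryB n (phi psi : cfun R G n.+1) : chain S T phi -> chain S T psi ->
  boundary (phi - psi) = boundary phi - boundary psi.
Proof.
by move=> cp cq; rewrite addrC -scaleN1r boundaryZD// scaleN1r addrC.
Qed.

Lemma chainB n (phi psi : cfun R G n) : chain S T phi -> chain S T psi ->
  chain S T (phi - psi).
Proof. by move=> cp cq; rewrite addrC -scaleN1r; exact: chainZD. Qed.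

Lemma chain_altsum n q (f : {ffun 'I_q.+1 -> G} -> cfun R G n) x :
  (forall y, chain S T (f y)) -> chain S T (altsum f x).
Proof.
move=> cf; rewrite /altsum; elim/big_rec: _ => [|j phi _ cp]; first exact: chain0.
exact: chainZD.
Qed.

Lemma boundary_altsum n q (f : {ffun 'I_q.+1 -> G} -> cfun R G n.+1) x :
  (forall y, chain S T (f y)) ->
  boundary (altsum f x) = altsum (fun y => boundary (f y)) x.
Proof.
move=> cf.
suff: chain S T (altsum f x) /\
    boundary (altsum f x) = altsum (fun y => boundary (f y)) x by case.
rewrite /altsum; elim/big_rec2: _ => [|j phi psi _ [cp <-]].
  by split; [exact: chain0|exact: boundary0].
by split; [exact: chainZD|rewrite boundaryZD].
Qed.

Lemma bd_tuple_translate n g (x : {ffun 'I_n.+2 -> G}) y :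
  bd_tuple R (translate g x) (translate g y) = bd_tuple R x y.
Proof.
rewrite /bd_tuple (asbool_equiv_eq (degenerate_translate g y)).
case: asboolP => // _; apply: eq_bigr => j _.
by rewrite face_translate (inj_eq (can_inj (@translateK _ _ g))).
Qed.

Lemma boundary_translate n g (phi : cfun R G n.+1) :
  boundary (phi \o translate g) = boundary phi \o translate g.
Proof.
apply/funext => y; rewrite /= /boundary.
rewrite [RHS](reindex_fsbigT (translate g)); last exact: translate_bij.
by apply: eq_fsbigr => x _; rewrite bd_tuple_translate.
Qed.

(** The projection of the standard resolution onto normalised chains. *)
Definition tuple_chain n (x : {ffun 'I_n.+1 -> G}) : cfun R G n :=
  if `[< degenerate x >] then 0 else delta R x.

Lemma bd_tupleE n (x : {ffun 'I_n.+2 -> G}) :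
  bd_tuple R x = altsum (@tuple_chain n) x.
Proof.
apply/funext => y.
have -> : altsum (@tuple_chain n) x y =
    \sum_(j < n.+2) (-1) ^+ j * tuple_chain (face j x) y.
  by rewrite /altsum; elim/big_ind2: _ => // u1 u2 v1 v2 <- <-.
rewrite /bd_tuple; case: asboolP => yd; last first.
  apply: eq_bigr => j _; congr (_ * _); rewrite /tuple_chain /delta eq_sym.
  by case: asboolP => // fd; case: eqP => // yf; case: yd; rewrite yf.
rewrite big1// => j _; rewrite /tuple_chain; case: asboolP => [_|fd].
  by rewrite mulr0.
by rewrite /delta; case: eqP => [yf|_]; [case: fd; rewrite -yf|rewrite mulr0].
Qed.

Lemma boundary_tuple_chain n (x : {ffun 'I_n.+2 -> G}) :
  boundary (tuple_chain x) = altsum (@tuple_chain n) x.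
Proof.
rewrite {1}/tuple_chain; case: asboolP => [xd|_]; last first.
  by rewrite boundary_tuple bd_tupleE.
rewrite boundary0; have [l xl] := (degenerateP _).1 xd.
have [i [j [il jl xij]]] := xl.
have ji : j = i.+1 :> nat by rewrite il.
rewrite (altsum_repeat _ ji xij) big1// => k /andP[ki kj].
have fd : degenerate (face k x).
  have kn : (k <= n.+1)%N by rewrite -ltnS.
  apply/degenerateP; rewrite -(inord_val k); have [kl|lk] := ltnP k l.
    by exists l.-1; exact: repeats_face.
  exists l; apply: repeats_face_above => //.
  by move: ki kj; rewrite -!val_eqE /= il jl => /eqP ? /eqP ?; lia.
by rewrite /tuple_chain asboolT// scaler0.
Qed.

Lemma small_exists n (x : {ffun 'I_n.+1 -> G}) : exists r, small S r x.
Proof.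
exists (\max_(p : 'I_n.+1 * 'I_n.+1) word_dist S (x p.1) (x p.2)) => i j.
exact: (leq_bigmax (i, j)).
Qed.

Lemma chain_tuple_chain n (x : {ffun 'I_n.+1 -> G}) : chain S T (tuple_chain x).
Proof.
rewrite /tuple_chain; case: asboolP => [_|xd]; first exact: chain0.
by have [r xr] := small_exists x; exists r; exact: chain_r_delta.
Qed.

End Boundary.

(** * Pairing invariant cochains with tempered chains *)

Section Pairing.
Variables (R : realType) (G : groupType) (S : seq G) (T : decay).
Hypothesis gS : generates S.

Definition pair n (c phi : cfun R G n) : R := rsum (fun t => c t * phi t).

(** Up to translation there are only finitely many small tuples. *)
Lemma cochain_bounded_on_small r n (c : cfun R G n) : cochain c ->
  exists M : R, forall t, small S r t -> `|c t| <= M.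
Proof.
move=> cc.
have [s sE] := (finite_seqP _).1
  (finite_small_at gS r (ord0 : 'I_n.+1) (finite_set1 (1%g : G))).
exists (\sum_(u <- s) `|c u|) => t tr.
rewrite -(cc (t ord0)^-1%g t); set u := translate _ t.
have us : u \in s.
  have : [set` s] u; last by [].
  by rewrite -sE; split; [exact/small_translate|rewrite /u /= ffunE mulVg].
by rewrite (big_rem _ us)/= lerDl; apply: sumr_ge0.
Qed.

Lemma pair_summable r n (c phi : cfun R G n) : cochain c -> chain_r S T r phi ->
  abs_summable (fun t => c t * phi t).
Proof.
move=> cc /(chain_rP _ gS)[sp _ dphi]; have [M cM] := cochain_bounded_on_small r cc.
apply: abs_summable_le (decaying_summable (decayingZ M dphi)) => t.
have [tr|/sp ->] := pselect (small S r t); last by rewrite !mulr0.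
by rewrite !normrM ler_wpM2r// (le_trans (cM t tr))// ler_norm.
Qed.

Lemma rsum_sign (I : choiceType) j (f : I -> R) :
  rsum (fun i => (-1) ^+ j * f i) = (-1) ^+ j * rsum f.
Proof.
rewrite -signr_odd; case: odd; last by under eq_fun do rewrite mul1r; rewrite mul1r.
by under eq_fun do rewrite mulN1r; rewrite mulN1r rsumN.
Qed.

Lemma pair_altsum n q (c : cfun R G n) (f : {ffun 'I_q.+1 -> G} -> cfun R G n) x :
  cochain c -> (forall y, chain S T (f y)) ->
  pair c (altsum f x) = \sum_(j < q.+2) (-1) ^+ j * pair c (f (face j x)).
Proof.
move=> cc cf; under eq_bigr do rewrite -rsum_sign.
have sf (j : 'I_q.+2) : abs_summable (fun t => (-1) ^+ j * (c t * f (face j x) t)).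
  have [r fr] := cf (face j x); apply: abs_summable_le (pair_summable cc fr) => t.
  by rewrite normrMsign.
have [_ <-] := abs_summable_sum sf; rewrite /pair; congr rsum.
apply/funext => t; rewrite [altsum f x t](_ : _ = \sum_(j < q.+2) (-1) ^+ j * f (face j x) t).
  by rewrite mulr_sumr; apply: eq_bigr => j _; rewrite mulrCA.
by rewrite /altsum; elim/big_ind2: _ => // u1 u2 v1 v2 <- <-.
Qed.

Lemma pairB n (c phi psi : cfun R G n) : cochain c ->
  chain S T phi -> chain S T psi -> pair c (phi - psi) = pair c phi - pair c psi.
Proof.
move=> cc [r hr] [s hs]; rewrite /pair -rsumN -rsumD.
- by congr rsum; apply/funext => t; rewrite -mulrBr.
- exact: pair_summable hr.
- apply: abs_summable_le (pair_summable cc hs) => t; by rewrite normrN.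
Qed.

Lemma pair_translate n g (c phi : cfun R G n) : cochain c ->
  pair c (phi \o translate g) = pair c phi.
Proof.
move=> cc; rewrite /pair -[RHS](rsum_reindex _ (translate_bij n g)).
by congr rsum; apply/funext => t /=; rewrite cc.
Qed.

Lemma pair_tuple_chain n (c : cfun R G n) x :
  (forall y, degenerate y -> c y = 0) -> pair c (tuple_chain R x) = c x.
Proof.
move=> cd; rewrite /pair /tuple_chain; case: asboolP => [xd|_].
  rewrite cd//; under eq_fun do rewrite mulr0; exact: rsum0.
rewrite (@rsum_single _ _ _ x) /delta ?eqxx ?mulr1// => j /eqP/negPf ->.
by rewrite mulr0.
Qed.

(** Interchanging the sums over tuples and over their faces. Normalisation of the
    cochain is essential, since the boundary map drops degenerate faces. *)
Lemma pair_boundary n (c : cfun R G n) (phi : cfun R G n.+1) : cochain c ->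
  (forall y, degenerate y -> c y = 0) -> chain S T phi ->
  pair c (boundary phi) = pair (coboundary c) phi.
Proof.
move=> cc cd [r hr]; have [sp _ _] := (chain_rP _ gS _ _).1 hr.
pose f (j : 'I_n.+2) t := (-1) ^+ j * (c (face j t) * phi t).
have sf j : abs_summable (f j).
  have cj : cochain (fun t => c (face j t) : R^o).
    by move=> g t; rewrite face_translate cc.
  by apply: abs_summable_le (pair_summable cj hr) => t; rewrite normrMsign.
have fib j := @rsum_fibres R _ _ (face j) (f j) (@cofaces G S r n)
  (fun y => finite_cofaces gS r y).
have fsupp j t : f j t <> 0 -> cofaces S r (face j t) t.
  move=> ft; split; last by exists j.
  by apply: contrapT => /sp pt; apply: ft; rewrite /f pt !mulr0.
have [_ e1] := abs_summable_sum sf.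
have [_ e2] := abs_summable_sum (fun j => (fib j (fsupp j) (sf j)).1).
transitivity (\sum_(j < n.+2) rsum (f j)).
  under [RHS]eq_bigr => j _ do rewrite -(fib j (fsupp j) (sf j)).2.
  rewrite -e2 /pair; congr rsum; apply/funext => y; rewrite (boundaryE y sp).
  have fin := finite_cofaces gS r y.
  under [RHS]eq_bigr do rewrite fsbig_finite//.
  rewrite fsbig_finite//= mulr_sumr exchange_big/=; apply: eq_bigr => x _.
  rewrite mulrCA; have -> : c y * bd_tuple R x y =
      \sum_(j < n.+2) (-1) ^+ j * (c (face j x) * (face j x == y)%:R).
    rewrite /bd_tuple; case: asboolP => [yd|_].
      rewrite mulr0 big1// => j _; case: eqP => [->|_]; last by rewrite !mulr0.
      by rewrite cd// mul0r mulr0.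
    rewrite mulr_sumr; apply: eq_bigr => j _; rewrite mulrCA; congr (_ * _).
    by case: eqP => [->|_]; rewrite ?mulr0.
  by rewrite mulr_sumr; apply: eq_bigr => j _; rewrite /f; ring.
rewrite -e1 /pair; congr rsum; apply/funext => t; rewrite /coboundary mulr_suml.
by apply: eq_bigr => j _; rewrite /f mulrA.
Qed.

End Pairing.

(** * The chain map and the homotopy *)

Section EquivariantLift.
Variables (R : realType) (G : groupType) (S : seq G) (T : decay).
Hypothesis gS : generates S.
Variable h : forall n, cfun R G n -> cfun R G n.+1.
Hypothesis hb : forall n, bounded_linear_map (@reduced_chain R G S T n)
  (@chain_bounded R G S T n) (@reduced_chain R G S T n.+1)
  (@chain_bounded R G S T n.+1) (@h n).
Hypothesis h0 : forall phi, @reduced_chain R G S T 0 phi -> boundary (h phi) = phi.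
Hypothesis hS : forall n (phi : cfun R G n.+1), reduced_chain S T phi ->
  boundary (h phi) + h (boundary phi) = phi.

Definition reduced_cycle (n : nat) : cfun R G n -> Prop :=
  match n return cfun R G n -> Prop with
  | 0 => fun phi => reduced_chain S T phi
  | m.+1 => fun phi => chain S T phi /\ boundary phi = 0
  end.

Lemma homotopy0 n : h (0 : cfun R G n) = 0.
Proof.
rewrite -{1}(scale0r (0 : cfun R G n)) (bounded_linear_scale (@hb n)) ?scale0r// => b.
rewrite scaler0; case: n => [|n]; last exact: chain0.
by split; [exact: chain0|exact: rsum0].
Qed.

Lemma boundary_homotopy n (phi : cfun R G n) : reduced_cycle phi ->
  boundary (h phi) = phi.
Proof.
case: n phi => [|n] phi; first exact: h0.
by move=> [cp bp]; have := hS cp; rewrite bp homotopy0 addr0.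
Qed.

Definition equivariant n q (Z : {ffun 'I_q.+1 -> G} -> cfun R G n) : Prop :=
  forall g x t, Z (translate g x) (translate g t) = Z x t.

(** The contraction is not equivariant; it is made so on a basis of the free
    module of tuples by translating the base vertex to the identity. *)
Definition equivariant_lift n q (Z : {ffun 'I_q.+1 -> G} -> cfun R G n) :
    {ffun 'I_q.+1 -> G} -> cfun R G n.+1 :=
  fun x => h (Z (translate (x ord0)^-1%g x)) \o translate (x ord0)^-1%g.

Lemma equivariant_equivariant_lift n q (Z : {ffun 'I_q.+1 -> G} -> cfun R G n) :
  equivariant (equivariant_lift Z).
Proof.
move=> g x t; rewrite /equivariant_lift /= !translateM !ffunE.
by rewrite invgM -mulgA mulVg mulg1.
Qed.

Lemma boundary_equivariant_lift n q (Z : {ffun 'I_q.+1 -> G} -> cfun R G n) x :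
  equivariant Z -> (forall y, reduced_cycle (Z y)) ->
  boundary (equivariant_lift Z x) = Z x.
Proof.
move=> eZ cZ; rewrite /equivariant_lift boundary_translate boundary_homotopy//.
by apply/funext => t; exact: eZ.
Qed.

Lemma equivariant_altsum n q (Z : {ffun 'I_q.+1 -> G} -> cfun R G n) :
  equivariant Z -> equivariant (altsum Z).
Proof.
have E x t : altsum Z x t = \sum_(j < q.+2) (-1) ^+ j * Z (face j x) t.
  by rewrite /altsum; elim/big_ind2: _ => // u1 u2 v1 v2 <- <-.
move=> eZ g x t; rewrite !E; apply: eq_bigr => j _.
by rewrite face_translate eZ.
Qed.

Fixpoint chain_map (n : nat) : {ffun 'I_n.+1 -> G} -> cfun R G n :=
  match n with
  | 0 => fun x => delta R x
  | m.+1 => equivariant_lift (altsum (@chain_map m))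
  end.

(** Each step applies the contraction to chains of uniformly bounded propagation,
    so the propagation of the values is bounded by a constant that does not depend
    on the tuple. *)
Lemma chain_map_spec n :
  [/\ equivariant (@chain_map n),
      exists r, forall x, chain_r S T r (@chain_map n x) &
      forall x, reduced_cycle (altsum (@chain_map n) x)].
Proof.
elim: n => [|n [eF [r Fr] cF]].
  have cr x : chain_r S T 0 (delta R x : cfun R G 0).
    by apply: chain_r_delta => //; [exact: small_vertex|exact: nondegenerate_vertex].
  split.
  - move=> g x t; rewrite /chain_map /delta.
    by rewrite (inj_eq (can_inj (@translateK _ _ g))).
  - by exists 0%N.
  - move=> x; rewrite /altsum !big_ord_recl big_ord0 addr0.
    rewrite expr0 expr1 scale1r scaleN1r.
    split; first by exists 0%N; exact: (chain_rB gS (cr _) (cr _)).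
    by rewrite -[_ - _]scale1r; exact: augmentation_deltaB.
have bF x : boundary (@chain_map n.+1 x) = altsum (@chain_map n) x.
  by apply: boundary_equivariant_lift => //; exact: equivariant_altsum.
have Fr' : exists r', forall x, chain_r S T r' (@chain_map n.+1 x).
  suff [r' hr'] : exists r', forall y, chain_r S T r' (h (altsum (@chain_map n) y)).
    by exists r' => x; apply: chain_r_translate => //; exact: hr'.
  case: n => [|n] in r eF Fr cF bF *.
    have [r' hr'] := uniform_propagation0 gS (@hb 0).
    exists r' => y; rewrite /altsum !big_ord_recl big_ord0 addr0.
    rewrite expr0 expr1 scale1r scaleN1r.
    exact: hr'.
  have [r' hr'] := uniform_propagation gS (@hb n.+1) r.
  by exists r' => y; apply: hr'; apply: chain_r_sum.
split=> //; first exact: equivariant_equivariant_lift.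
have cc x : chain S T (@chain_map n.+1 x) by have [r' hr'] := Fr'; exists r'.
move=> x; split; first exact: chain_altsum.
by rewrite (boundary_altsum (T := T) gS)//; rewrite (eq_altsum _ bF) altsum_altsum.
Qed.

Lemma chain_chain_map n x : chain S T (@chain_map n x).
Proof. by have [_ [r hr] _] := chain_map_spec n; exists r. Qed.

Lemma boundary_chain_map n x :
  boundary (@chain_map n.+1 x) = altsum (@chain_map n) x.
Proof.
have [eF _ cF] := chain_map_spec n.
by apply: boundary_equivariant_lift => //; exact: equivariant_altsum.
Qed.

(** What the next component of the homotopy has to bound. *)
Definition homotopy_defect n (H : {ffun 'I_n.+1 -> G} -> cfun R G n.+1) :
    {ffun 'I_n.+2 -> G} -> cfun R G n.+1 :=
  fun x => tuple_chain R x - @chain_map n.+1 x - altsum H x.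

Fixpoint chain_homotopy (n : nat) : {ffun 'I_n.+1 -> G} -> cfun R G n.+1 :=
  match n with
  | 0 => fun=> 0
  | m.+1 => equivariant_lift (homotopy_defect (@chain_homotopy m))
  end.

Lemma equivariant_tuple_chain n : equivariant (@tuple_chain R G n).
Proof.
move=> g x t; rewrite /tuple_chain (asbool_equiv_eq (degenerate_translate g x)).
case: asboolP => // _; rewrite /delta.
by rewrite (inj_eq (can_inj (@translateK _ _ g))).
Qed.

Lemma equivariant_defect n (H : {ffun 'I_n.+1 -> G} -> cfun R G n.+1) :
  equivariant H -> equivariant (homotopy_defect H).
Proof.
move=> eH g x t; have [eF _ _] := chain_map_spec n.+1.
have E y u : homotopy_defect H y u =
  tuple_chain R y u - @chain_map n.+1 y u - altsum H y u by [].
by rewrite !E equivariant_tuple_chain eF (equivariant_altsum eH).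
Qed.

Lemma boundary_defect n (H : {ffun 'I_n.+1 -> G} -> cfun R G n.+1) x :
  (forall y, chain S T (H y)) -> boundary (homotopy_defect H x) =
  altsum (fun y => tuple_chain R y - @chain_map n y - boundary (H y)) x.
Proof.
move=> cH; have cI := chain_tuple_chain R T gS x; have cF := @chain_chain_map n.+1 x.
have cA : chain S T (altsum H x) by exact: chain_altsum.
rewrite /homotopy_defect !(boundaryB (T := T) gS) ?chainB//.
- by rewrite boundary_tuple_chain boundary_chain_map (boundary_altsum (T := T) gS)// !altsumB.
- exact: chainB.
Qed.

Lemma chain_homotopy_spec n :
  [/\ equivariant (@chain_homotopy n),
      forall x, chain S T (@chain_homotopy n x) &
      forall x, boundary (homotopy_defect (@chain_homotopy n) x) = 0].
Proof.
elim: n => [|n [eH cH bH]].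
  have c0 x : chain S T (@chain_homotopy 0 x) by exact: chain0.
  split=> // x; rewrite boundary_defect// [LHS]big1// => j _.
  rewrite boundary0 subr0 /tuple_chain asboolF; last exact: nondegenerate_vertex.
  by rewrite subrr scaler0.
have cZ y : reduced_cycle (homotopy_defect (@chain_homotopy n) y).
  split=> //; rewrite /homotopy_defect; apply: chainB => //; last exact: chain_altsum.
  by apply: chainB => //; [exact: chain_tuple_chain|exact: chain_chain_map].
have cH' x : chain S T (@chain_homotopy n.+1 x).
  have [hC _ _] := @hb n.+1.
  have [|r hr] := hC (homotopy_defect (@chain_homotopy n) (translate (x ord0)^-1%g x)).
    by have [] := cZ (translate (x ord0)^-1%g x).
  by exists r; exact: chain_r_translate.
split=> //; first exact: equivariant_equivariant_lift.
move=> x; rewrite boundary_defect//.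
rewrite (eq_altsum (g := altsum (@chain_homotopy n))) ?altsum_altsum// => y.
rewrite boundary_equivariant_lift//; last exact: equivariant_defect.
by rewrite /homotopy_defect opprB addrC subrK.
Qed.

Lemma boundary_chain_homotopy n x :
  boundary (@chain_homotopy n.+1 x) = homotopy_defect (@chain_homotopy n) x.
Proof.
have [eH cH bH] := chain_homotopy_spec n.
apply: boundary_equivariant_lift; first exact: equivariant_defect.
move=> y; split=> //; apply: chainB => //; last exact: chain_altsum.
by apply: chainB => //; [exact: chain_tuple_chain|exact: chain_chain_map].
Qed.

(** Pairing with the homotopy formula, in which the chain map contributes nothing
    because its values consist of small tuples. *)
Lemma normalised_cocycle_small_coboundary n : exists r, forall c : cfun R G n.+1,
  cocycles c -> (forall x, small S r x -> c x = 0) ->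
  (forall x, degenerate x -> c x = 0) -> coboundaries c.
Proof.
have [_ [r Fr] _] := chain_map_spec n.+1.
have [eH cH _] := chain_homotopy_spec n.
have [_ cH' _] := chain_homotopy_spec n.+1.
exists r => c [cc dc] csmall cdeg.
exists (fun y => pair c (@chain_homotopy n y) : R^o).
  move=> g x; rewrite -[RHS](pair_translate g^-1%g _ cc); congr pair.
  by apply/funext => t; rewrite /= -[in LHS](translateVK g t) eH.
apply/funext => x; rewrite /coboundary -(pair_altsum gS _ cc cH).
have -> : altsum (@chain_homotopy n) x =
    tuple_chain R x - @chain_map n.+1 x - boundary (@chain_homotopy n.+1 x).
  by rewrite boundary_chain_homotopy /homotopy_defect opprB addrC subrK.
have cI := chain_tuple_chain R T gS x; have cF := @chain_chain_map n.+1 x.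
have cB : chain S T (boundary (@chain_homotopy n.+1 x)).
  rewrite boundary_chain_homotopy; apply: chainB => //; last exact: chain_altsum.
  exact: chainB.
rewrite !(pairB (T := T) gS cc)//; last exact: chainB.
rewrite (pair_tuple_chain _ cdeg) (pair_boundary gS cc cdeg (cH' x)) dc.
have -> : pair c (@chain_map n.+1 x) = 0.
  rewrite /pair -[RHS](rsum0 R {ffun 'I_n.+2 -> G}); congr rsum; apply/funext => t.
  have [sp _ _] := (chain_rP _ gS _ _).1 (Fr x).
  by have [/csmall ->|/sp ->] := pselect (small S r t); rewrite ?mul0r ?mulr0.
have -> : pair 0 (@chain_homotopy n.+1 x) = 0.
  rewrite /pair -[RHS](rsum0 R {ffun 'I_n.+3 -> G}); congr rsum; apply/funext => t.
  by rewrite mul0r.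
by rewrite !subr0.
Qed.

End EquivariantLift.

(** * Finiteness of group cohomology *)

Section Finiteness.
Variables (R : realType) (G : groupType) (S : seq G).
Hypothesis gS : generates S.

Lemma cocyclesZD n (a : R) (f g : cfun R G n) :
  cocycles f -> cocycles g -> cocycles (a *: f + g).
Proof.
move=> [cf df] [cg dg]; split.
  by move=> t x; rewrite [LHS](_ : _ = a * f (translate t x) + g (translate t x))// cf cg.
rewrite -[g]opprK coboundaryB coboundaryZ df scaler0 sub0r.
by rewrite -[- g]scaleN1r coboundaryZ dg scaler0 oppr0.
Qed.

(** By invariance, a cocycle that vanishes on the finitely many small tuples with
    base vertex 1 vanishes on all small tuples. *)
Lemma finite_dim_of_small n r :
  (forall c : cfun R G n, cocycles c -> (forall x, small S r x -> c x = 0) ->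
     coboundaries c) ->
  finite_dim_group_cohomology R G n.
Proof.
move=> small_cob.
have [s sE] := (finite_seqP _).1
  (finite_small_at gS r (ord0 : 'I_n.+1) (finite_set1 (1%g : G))).
apply: (@finite_dim_quotient_functionals _ _ _ (fun t (c : cfun R G n) => c t : R) s).
- by [].
- by move=> a u v; exact: cocyclesZD.
move=> z cz zs; apply: small_cob => // x xr; have [inv _] := cz.
rewrite -(inv (x ord0)^-1%g x); apply: zs.
have : [set` s] (translate (x ord0)^-1%g x); last by [].
by rewrite -sE; split; [exact/small_translate|rewrite /= ffunE mulVg].
Qed.

End Finiteness.

Theorem theorem9 (R : realType) (G : groupType) (S : seq G) (T : decay) :
  generates S ->
  contractible_reduced_complex R S T ->
  forall n : nat, finite_dim_group_cohomology R G n.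
Proof.
move=> gS [h [hb h0 hS]] [|n].
  apply: (finite_dim_of_small gS (r := 0)) => c _ c0.
  by apply/funext => x; apply: c0; exact: small_vertex.
have [r rcob] := normalised_cocycle_small_coboundary gS hb h0 hS n.
apply: (finite_dim_of_small gS (r := r)) => c zc csmall.
have [b [cb zb sb db]] := normalise zc csmall.
have [b' cb' e] := rcob _ zb sb db.
exists (b' - (-1) *: b); first exact: cochainB.
by rewrite coboundaryB coboundaryZ e scaleN1r opprK subrK.
Qed.
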